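(* Let $L$ be a language consisting of relation symbols and unary function symbols equipped with a permutation group $\Gamma_L$, let $\mathbf A$ be a finite irreducible $\Gamma_L$-structure, let $\mathbf B_0$ be a finite EPPA-witness for $\mathbf A$ and let $n\ge 1$ be an integer. There is a finite $\Gamma_L$-structure $\mathbf B$ satisfying the following. (1) $\mathbf B$ is an irreducible structure faithful EPPA-witness for $\mathbf A$. (2) There is a homomorphism-embedding $\mathbf B\to\mathbf B_0$. (3) For every substructure $\mathbf C$ of $\mathbf B$ on at most $n$ vertices there is a tree amalgamation $\mathbf D$ of copies of $\mathbf A$ and a homomorphism-embedding $f\colon\mathbf C\to\mathbf D$. (4) If $\mathbf B_0$ is a coherent EPPA-witness for $\mathbf A$, then so is $\mathbf B$.
   Context: Structures. A language $L$ consists of relation symbols $R$ (of arity $a(R)\ge 1$) and function symbols $F$ (of arity $a(F)\ge 0$; $F$ is unary if $a(F)=1$). $L$ is equipped with a permutation group $\Gamma_L$ if $\Gamma_L$ is a group of permutations of $L$ mapping relation symbols to relation symbols and function symbols to function symbols and preserving arities. A $\Gamma_L$-structure $\mathbf A$ has a finite or countably infinite vertex set $A$, a relation $R_{\mathbf A}\subseteq A^{a(R)}$ for each relation symbol $R\in L$, and a function $F_{\mathbf A}\colon A^{a(F)}\to\mathcal P(A)$ (the power set of $A$) for each function symbol $F\in L$. It is finite if $A$ is finite. Maps. A homomorphism $f\colon\mathbf A\to\mathbf B$ is a pair $f=(f_L,f_A)$ with $f_L\in\Gamma_L$ and $f_A\colon A\to B$ such that, for all $R,F\in L$ and all tuples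 $\bar x$, $\bar x\in R_{\mathbf A}$ implies $f_A(\bar x)\in f_L(R)_{\mathbf B}$, and $f_A(F_{\mathbf A}(\bar x))\subseteq f_L(F)_{\mathbf B}(f_A(\bar x))$. It is an embedding if $f_A$ is injective, the implication is an equivalence and the inclusion is an equality. An isomorphism is an embedding with $f_A$ bijective; an automorphism is an isomorphism of a structure to itself. Maps compose componentwise (language parts and vertex parts). $\mathbf A$ is a substructure of $\mathbf B$ if $A\subseteq B$ and the pair ($\mathrm{id}_L$, inclusion) is an embedding. For an embedding $f\colon\mathbf A\to\mathbf B$, $f(\mathbf A)$ is the substructure of $\mathbf B$ with vertex set $f_A(A)$; for a vertex set $X$, $f(X)=f_A(X)$. Irreducibility. Given embeddings $\alpha_i\colon\mathbf A\to\mathbf B_i$ ($i=1,2$), an amalgamation of $\mathbf B_1,\mathbf B_2$ over $\mathbf A$ with respect to $\alpha_1,\alpha_2$ is a structure $\mathbf C$ with embeddings $\beta_i\colon\mathbf B_i\to\mathbf C$ such that $\beta_1\alpha_1=\beta_2\alpha_2$ (including language parts). It is strong if $\beta_1(B_1)\cap\beta_2(B_2)=\beta_1\alpha_1(A)$. A strong amalgamation is free if $C=\beta_1(B_1)\cup\beta_2(B_2)$ and whenever a tuple $\bar x$ of vertices of $\mathbf C$ contains vertices of both $\beta_1(B_1\setminus\alpha_1(A))$ and $\beta_2(B_2\setminus\alpha_2(A))$, then $\bar x$ is in no relation of $\mathbf C$ and $F_{\mathbf C}(\bar x)=\emptyset$ for every $F\in L$ of the corresponding arity. A structure is irreducible if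 it is not a free amalgamation of two of its proper substructures (over a common substructure, with respect to inclusions). A homomorphism $f\colon\mathbf A\to\mathbf B$ is a homomorphism-embedding if its restriction to every irreducible substructure of $\mathbf A$ is an embedding. Tree amalgamation. Tree amalgamations of copies of $\mathbf A$ are defined recursively: (i) every $\mathbf D$ isomorphic to $\mathbf A$ is one; (ii) if $\mathbf B_1,\mathbf B_2$ are tree amalgamations of copies of $\mathbf A$, $\mathbf D$ is a $\Gamma_L$-structure and $\alpha_1\colon\mathbf A\to\mathbf B_1$, $\alpha_2\colon\mathbf A\to\mathbf B_2$, $\delta_1,\delta_2\colon\mathbf D\to\mathbf A$ are embeddings, then the free amalgamation of $\mathbf B_1$ and $\mathbf B_2$ over $\mathbf D$ with respect to $\alpha_1\circ\delta_1$ and $\alpha_2\circ\delta_2$ is one. EPPA. A partial automorphism of $\mathbf A$ is an isomorphism $f$ between substructures of $\mathbf A$; its language part $f_L\in\Gamma_L$ is part of the data, and $\mathrm{dom}(f)$, $\mathrm{range}(f)$ refer to its vertex part. An automorphism $\theta$ extends $f$ if $\theta$ has the same language part as $f$ and its vertex part extends that of $f$. A finite $\mathbf B$ is an EPPA-witness for a finite $\mathbf A$ if there is an embedding $\psi\colon\mathbf A\to\mathbf B$ such that every partial automorphism of $\psi(\mathbf A)$ extends to an automorphism of $\mathbf B$. It is coherent if moreover (for this $\psi$) one can choose, for each partial automorphism $f$ of $\psi(\mathbf A)$, an automorphism $\hat f$ of $\mathbf B$ extending $f$ so that $\widehat{gf}=\hat g\hat f$ whenever $\mathrm{range}(f)=\mathrm{dom}(g)$.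 It is irreducible structure faithful if (for this $\psi$) for every irreducible substructure $\mathbf C$ of $\mathbf B$ there is an automorphism $g$ of $\mathbf B$ with $g(C)\subseteq\psi(A)$. *)

(* Defs.v *)
From mathcomp Require Import all_boot.
From mathcomp Require Import boolp classical_sets functions cardinality.

Set Implicit Arguments.
Unset Strict Implicit.
Unset Printing Implicit Defensive.

Local Open Scope classical_set_scope.

(* [lang_grp] is the permutation group of the language.  A permutation of the
   language is the pair of its actions on relation and on function symbols;
   bijectivity of both actions follows from [lang_grpV]. *)
Record language := Language {
  rel_sym : Type;
  fun_sym : Type;
  rel_ar : rel_sym -> nat;
  fun_ar : fun_sym -> nat;
  rel_ar_gt0 : forall R, 0 < rel_ar R;
  lang_grp : set ((rel_sym -> rel_sym) * (fun_sym -> fun_sym));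
  lang_grp_rel_ar : forall p, lang_grp p -> forall R, rel_ar (p.1 R) = rel_ar R;
  lang_grp_fun_ar : forall p, lang_grp p -> forall F, fun_ar (p.2 F) = fun_ar F;
  lang_grp1 : lang_grp (id, id);
  lang_grpM : forall p q,
    lang_grp p -> lang_grp q -> lang_grp (p.1 \o q.1, p.2 \o q.2);
  lang_grpV : forall p, lang_grp p -> exists2 q, lang_grp q &
    [/\ cancel p.1 q.1, cancel q.1 p.1, cancel p.2 q.2 & cancel q.2 p.2]
}.

Definition unary_functions (L : language) : Prop :=
  forall F : fun_sym L, fun_ar F = 1.

(* Tuples are sequences, so that a symbol and its image under a language
   permutation act on the same type of tuples.  [srel_size] and [sfun_size]
   make relations and function values empty outside of the right arity. *)
Record structure (L : language) := Structure {
  vertex :> countType;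
  srel : rel_sym L -> seq vertex -> Prop;
  sfun : fun_sym L -> seq vertex -> set vertex;
  srel_size : forall R s, srel R s -> size s = rel_ar R;
  sfun_size : forall F s x, sfun F s x -> size s = fun_ar F
}.

Definition finite_structure (L : language) (A : structure L) : Prop :=
  finite_set [set: A].

Section Maps.
Context {L : language}.
Implicit Types A B C : structure L.

Record smap A B := SMap {
  lmap : (rel_sym L -> rel_sym L) * (fun_sym L -> fun_sym L);
  vmap :> A -> B
}.

Definition scomp A B C (g : smap B C) (f : smap A B) : smap A C :=
  SMap ((lmap g).1 \o (lmap f).1, (lmap g).2 \o (lmap f).2) (vmap g \o vmap f).

Definition is_hom A B (f : smap A B) : Prop :=
  [/\ lang_grp (lmap f),
      forall R s, srel R s -> srel ((lmap f).1 R) (map f s) &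
      forall F s, f @` sfun F s `<=` sfun ((lmap f).2 F) (map f s)].

Definition is_embedding A B (f : smap A B) : Prop :=
  [/\ lang_grp (lmap f),
      injective f,
      forall R s, srel R s <-> srel ((lmap f).1 R) (map f s) &
      forall F s, f @` sfun F s = sfun ((lmap f).2 F) (map f s)].

Definition is_isomorphism A B (f : smap A B) : Prop :=
  is_embedding f /\ bijective f.

Definition is_automorphism B (f : smap B B) : Prop := is_isomorphism f.

Definition isomorphic A B : Prop := exists f : smap A B, is_isomorphism f.

End Maps.

(* A substructure is determined by its vertex set; the vertex sets that occur
   are those closed under the functions (see [incl_embedding] and
   [embedding_closed]). *)
Record substr (L : language) (A : structure L) := Substr {
  sset : set A;
  sset_closed : forall F (s : seq A),
    {in s, forall x, sset x} -> sfun F s `<=` sset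
}.

Section Induced.
Context {L : language} {A : structure L}.
Variable X : substr A.

Let V : countType := {x : A | x \in sset X}.

Definition induced_rel R (s : seq V) : Prop := srel R (map val s).
Definition induced_fun F (s : seq V) : set V :=
  [set x | sfun F (map val s) (val x)].

Fact induced_rel_size R s : induced_rel R s -> size s = rel_ar R.
Proof. by move/srel_size; rewrite size_map. Qed.

Fact induced_fun_size F s x : induced_fun F s x -> size s = fun_ar F.
Proof. by move/sfun_size; rewrite size_map. Qed.

Definition induced : structure L := Structure induced_rel_size induced_fun_size.

End Induced.

Coercion induced : substr >-> structure.

Section Substructures.
Context {L : language}.
Implicit Types A B C : structure L.

Definition incl A (X : substr A) : smap X A :=
  SMap (id, id) (val : X -> A).

Lemma incl_embedding A (X : substr A) : is_embedding (incl X).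
Proof.
split => //=; [exact: lang_grp1|exact: val_inj|].
move=> F s; apply/seteqP; split => [_ [x Fx <-]//|x Fx].
have Xx : x \in sset X.
  apply/mem_set/(sset_closed _ Fx) => _ /mapP[y _ ->].
  exact: set_mem (valP y).
by exists (exist _ x Xx).
Qed.

Fact sub_incl_in A (X Y : substr A) (XY : sset X `<=` sset Y) (x : X) :
  val x \in sset Y.
Proof. exact/mem_set/XY/set_mem/(valP x). Qed.

Definition sub_incl A (X Y : substr A) (XY : sset X `<=` sset Y) : smap X Y :=
  SMap (id, id) (fun x : X => exist _ (val x) (sub_incl_in XY x) : Y).

Lemma embedding_closed A B (f : smap A B) : is_embedding f ->
  forall F s, {in s, forall y, range f y} -> sfun F s `<=` range f.
Proof.
move=> [Gf _ _ ff] F s sf y.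
have [t ->] : exists t, s = map f t.
  elim: s sf => [|z s IHs] sf; first by exists [::].
  have [x _ <-] := sf z (mem_head _ _).
  have [|t ->] := IHs; last by exists (x :: t).
  by move=> u us; apply: sf; rewrite inE us orbT.
have [q _ [_ _ _ qK]] := lang_grpV Gf.
by rewrite -(qK F) -ff => -[x _ <-]; exists x.
Qed.

Definition image_substr A B (f : smap A B) (f_emb : is_embedding f) : substr B :=
  Substr (embedding_closed f_emb).

End Substructures.

Section Amalgamation.
Context {L : language}.
Implicit Types A B C D : structure L.

Definition is_amalgamation A B1 B2 C
    (a1 : smap A B1) (a2 : smap A B2) (b1 : smap B1 C) (b2 : smap B2 C) : Prop :=
  [/\ is_embedding a1, is_embedding a2, is_embedding b1, is_embedding b2 &
      scomp b1 a1 = scomp b2 a2].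

Definition is_strong_amalgamation A B1 B2 C
    (a1 : smap A B1) (a2 : smap A B2) (b1 : smap B1 C) (b2 : smap B2 C) : Prop :=
  is_amalgamation a1 a2 b1 b2 /\
  range b1 `&` range b2 = range (scomp b1 a1).

Definition is_free_amalgamation A B1 B2 C
    (a1 : smap A B1) (a2 : smap A B2) (b1 : smap B1 C) (b2 : smap B2 C) : Prop :=
  [/\ is_strong_amalgamation a1 a2 b1 b2,
      range b1 `|` range b2 = [set: C] &
      forall (s : seq C) (x y : C), x \in s -> y \in s ->
        (b1 @` (~` range a1)) x -> (b2 @` (~` range a2)) y ->
        (forall R, ~ srel R s) /\ (forall F, sfun F s = set0)].

Definition proper_substr A (X : substr A) : Prop := sset X <> [set: A].

Definition irreducible A : Prop :=
  ~ exists (X Y Z : substr A) (ZX : sset Z `<=` sset X) (ZY : sset Z `<=` sset Y),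
      [/\ proper_substr X, proper_substr Y &
          is_free_amalgamation (sub_incl ZX) (sub_incl ZY) (incl X) (incl Y)].

Definition is_hom_embedding A B (f : smap A B) : Prop :=
  is_hom f /\
  forall X : substr A, irreducible X -> is_embedding (scomp f (incl X)).

Inductive tree_amalgamation A : structure L -> Prop :=
| tree_copy D : isomorphic A D -> tree_amalgamation A D
| tree_glue B1 B2 D C
    (a1 : smap A B1) (a2 : smap A B2) (d1 d2 : smap D A)
    (b1 : smap B1 C) (b2 : smap B2 C) :
    tree_amalgamation A B1 -> tree_amalgamation A B2 ->
    is_embedding a1 -> is_embedding a2 ->
    is_embedding d1 -> is_embedding d2 ->
    is_free_amalgamation (scomp a1 d1) (scomp a2 d2) b1 b2 ->
    tree_amalgamation A C.

End Amalgamation.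

Section EPPA.
Context {L : language}.
Implicit Types A B : structure L.

(* A partial automorphism of [A] is [f : smap X Y], with [X Y : substr A] and
   [is_isomorphism f]. *)

(* [S] plays the role of the copy of [A] inside [B], and [f] is a map between
   substructures of [S]. *)
Definition extends B (S : substr B) (X Y : substr S)
    (f : smap X Y) (t : smap B B) : Prop :=
  lmap t = lmap f /\ forall x : X, t (val (val x)) = val (val (f x)).

Definition eppa_for A B (psi : smap A B) : Prop :=
  exists psi_emb : is_embedding psi,
  forall (X Y : substr (image_substr psi_emb)) (f : smap X Y),
    is_isomorphism f ->
    exists t : smap B B, is_automorphism t /\ extends f t.

Definition coherent_for A B (psi : smap A B) : Prop :=
  exists (psi_emb : is_embedding psi)
    (hat : forall X Y : substr (image_substr psi_emb), smap X Y -> smap B B),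
    (forall (X Y : substr (image_substr psi_emb)) (f : smap X Y), is_isomorphism f ->
       is_automorphism (hat X Y f) /\ extends f (hat X Y f)) /\
    (forall (X Y Z : substr (image_substr psi_emb)) (f : smap X Y) (g : smap Y Z),
       is_isomorphism f -> is_isomorphism g ->
       hat X Z (scomp g f) = scomp (hat Y Z g) (hat X Y f)).

Definition irreducible_structure_faithful_for A B (psi : smap A B) : Prop :=
  forall C : substr B, irreducible C ->
    exists g : smap B B, is_automorphism g /\ g @` sset C `<=` range psi.

Definition eppa_witness A B : Prop :=
  exists psi : smap A B, eppa_for psi.

Definition coherent_eppa_witness A B : Prop :=
  exists psi : smap A B, eppa_for psi /\ coherent_for psi.

Definition irreducible_structure_faithful_eppa_witness A B : Prop :=
  exists psi : smap A B, eppa_for psi /\ irreducible_structure_faithful_for psi.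

End EPPA.

(* Main.v *)
Require Import Defs.
From HB Require Import structures.
From mathcomp Require Import all_boot.
From mathcomp Require Import fingroup perm.
From mathcomp Require Import boolp classical_sets functions cardinality.

(* Given a finite structure [B] with a symmetric "guard" relation and a copy of
   [A] all of whose pairs are guarded, take the structure [B'] of pairs
   [(x, chi)], where the valuation [chi] assigns one of [m] colours to every
   vertex [u] in the closure of [x] and every pattern [J] containing [u]; a
   pattern prescribes, for pairs of its vertices, whether their colours agree.
   Two vertices of [B'] are guarded when their projections are and the colours
   obey all patterns, and only guarded tuples are related.  Only patterns which
   are colourable on every copy of [A] are used, so the copy of [A] lifts.  An
   automorphism of [B] lifts along with any permutations of the colours of each
   pattern; hence partial automorphisms of the copy extend, and coherently so
   since partial permutations extend to permutations functorially.

   A pattern that is colourable on all copies of [A] but not on the whole of its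
   support can not be lifted to [B'].  Starting from [B0] with all pairs guarded,
   the choices [m = 0, 1, 2, ...] destroy, by the pigeonhole principle, all
   cliques of the guard relation that are not contained in a copy of [A].
   Continuing with [m = 2], a set [S] either loses guarded pairs when lifted or,
   given a non-guarded pair of [S], is separated by a clique: two non-guarded
   vertices of a minimal separator would be on a closed walk carrying a pattern
   with a single disagreement, which is not 2-colourable.  As
   a set with at most [n] elements has at most [n ^ 2] pairs, after [n ^ 2 + 1]
   steps every such set decomposes along cliques into a tree of copies of [A]. *)

Set Implicit Arguments.
Unset Strict Implicit.
Unset Printing Implicit Defensive.

(** * Partial injections *)

Section PartialInjections.
Variable T : finType.
Implicit Types r : rel T.

Definition partial_inj r :=
  forall i j i' j', r i j -> r i' j' -> (i == i') = (j == j').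

Definition pdom r : pred T := fun i => [exists j, r i j].
Definition pran r : pred T := fun j => [exists i, r i j].

(* Outside of the domain, the complements of the domain and of the range are
   matched in the order of their enumerations; this canonical choice makes the
   extension functorial. *)
Definition pext r (i : T) : T :=
  if [pick j | r i j] is Some j then j
  else nth i (enum [predC pran r]) (index i (enum [predC pdom r])).

Lemma pextE r i j : partial_inj r -> r i j -> pext r i = j.
Proof.
rewrite /pext => rP rij; case: pickP => [k rik|/(_ j)]; last by rewrite rij.
by apply/eqP; rewrite -(rP _ _ _ _ rik rij).
Qed.

Lemma pext_out r i : ~~ pdom r i ->
  pext r i = nth i (enum [predC pran r]) (index i (enum [predC pdom r])).
Proof.
rewrite /pext => /existsPn ri; case: pickP => // j rij.
by move: (ri j); rewrite rij.
Qed.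

(** The range is covered by the image of the domain under [pext r], so the complement of the domain
    is at most as large as that of the range. Hence the default value of [nth] in [pext] is never
    reached. *)
Lemma pext_index_lt r i : partial_inj r -> ~~ pdom r i ->
  index i (enum [predC pdom r]) < size (enum [predC pran r]).
Proof.
move=> rP ri; apply: (@leq_trans (size (enum [predC pdom r]))).
  by rewrite index_mem mem_enum inE.
rewrite -!cardE -(leq_add2l #|pdom r|) cardC.
rewrite -[X in X <= _](cardC (pran r)) leq_add2r.
apply: leq_trans (leq_image_card (pext r) (pdom r)).
apply/subset_leq_card/fintype.subsetP => j /existsP[i' rij].
by rewrite -(pextE rP rij); apply: fintype.image_f; apply/existsP; exists j.
Qed.

Lemma pext_outP r i : partial_inj r -> ~~ pdom r i -> ~~ pran r (pext r i).
Proof.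
move=> rP ri; have := pext_index_lt rP ri.
by rewrite pext_out // => /(mem_nth i); rewrite mem_enum inE.
Qed.

Lemma pext_inj r : partial_inj r -> injective (pext r).
Proof.
move=> rP i i' eqi.
have [/existsP[j rij]|ri] := boolP (pdom r i);
  have [/existsP[j' rij']|ri'] := boolP (pdom r i').
- by apply/eqP; rewrite (rP _ _ _ _ rij rij') -(pextE rP rij) eqi (pextE rP rij').
- have := pext_outP rP ri'; rewrite -eqi (pextE rP rij) => /existsPn/(_ i).
  by rewrite rij.
- have := pext_outP rP ri; rewrite eqi (pextE rP rij') => /existsPn/(_ i').
  by rewrite rij'.
- move: eqi; rewrite !pext_out // (set_nth_default i) ?pext_index_lt // => /eqP.
  rewrite nth_uniq ?enum_uniq ?pext_index_lt // => /eqP eqi.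
  have ii : i \in enum [predC pdom r] by rewrite mem_enum.
  have ii' : i' \in enum [predC pdom r] by rewrite mem_enum.
  by rewrite -(nth_index i ii) eqi nth_index.
Qed.

(** The complement of the range of [r1] and that of the domain of [r2] have the same enumeration, so
    the position of an unmatched element is passed on unchanged. *)
Lemma pext_comp r1 r2 r3 i : partial_inj r1 -> partial_inj r2 ->
  (forall i k, r3 i k <-> exists2 j, r1 i j & r2 j k) ->
  pran r1 =1 pdom r2 ->
  pext r3 i = pext r2 (pext r1 i).
Proof.
move=> r1P r2P r3E eqd.
have r3P : partial_inj r3.
  move=> i1 k1 i2 k2 /r3E[j1 rij1 rjk1] /r3E[j2 rij2 rjk2].
  by rewrite (r1P _ _ _ _ rij1 rij2) (r2P _ _ _ _ rjk1 rjk2).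
have dom3 : pdom r3 =1 pdom r1.
  move=> i'; apply/existsP/existsP => [[k /r3E[j rij _]]|[j rij]].
    by exists j.
  have : pran r1 j by apply/existsP; exists i'.
  by rewrite eqd => /existsP[k rjk]; exists k; apply/r3E; exists j.
have ran3 : pran r3 =1 pran r2.
  move=> k; apply/existsP/existsP => [[i' /r3E[j _ rjk]]|[j rjk]].
    by exists j.
  have : pdom r2 j by apply/existsP; exists k.
  by rewrite -eqd => /existsP[i' rij]; exists i'; apply/r3E; exists j.
have [/existsP[j rij]|ri] := boolP (pdom r1 i).
  have : pran r1 j by apply/existsP; exists i.
  rewrite eqd => /existsP[k rjk].
  rewrite (pextE r1P rij) (pextE r2P rjk); apply: pextE => //.
  by apply/r3E; exists j.
have ri2 : ~~ pdom r2 (pext r1 i) by rewrite -eqd pext_outP.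
have ri3 : ~~ pdom r3 i by rewrite dom3.
rewrite (pext_out ri2) (pext_out ri3).
have -> : enum [predC pdom r3] = enum [predC pdom r1].
  by apply: eq_enum => x; apply: (congr1 negb (dom3 x)).
have -> : enum [predC pran r3] = enum [predC pran r2].
  by apply: eq_enum => x; apply: (congr1 negb (ran3 x)).
have -> : enum [predC pdom r2] = enum [predC pran r1].
  by apply: eq_enum => x; apply: (congr1 negb (esym (eqd x))).
have lt1 := pext_index_lt r1P ri.
rewrite (pext_out ri) index_uniq ?enum_uniq //.
(* The two sides differ only in the default of [nth], which is irrelevant because the index is small
   enough. *)
apply: set_nth_default; apply: leq_trans lt1 _.
rewrite -!cardE -(leq_add2l #|pran r1|) cardC.
rewrite -[X in X <= _](cardC (pran r2)) leq_add2r (eq_card eqd).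
apply: leq_trans (leq_image_card (pext r2) (pdom r2)).
apply/subset_leq_card/fintype.subsetP => k /existsP[j rjk].
by rewrite -(pextE r2P rjk); apply: fintype.image_f; apply/existsP; exists k.
Qed.

End PartialInjections.

(** * Guarded structures and their lifts *)

Section GuardedStructures.
Variables (L : language) (A : Type).

Definition lperm : Type := (rel_sym L -> rel_sym L) * (fun_sym L -> fun_sym L).

Definition lcomp (q p : lperm) : lperm := (q.1 \o p.1, q.2 \o p.2).

(* The guard marks the pairs of vertices that are allowed to lie in a common
   copy of [A]; [chart] is the distinguished copy. *)
Record gstr := GStr {
  gvert :> finType;
  gsrel : rel_sym L -> seq gvert -> Prop;
  gfun : fun_sym L -> gvert -> gvert -> Prop;
  guard : rel gvert;
  chart : A -> gvert
}.

Record gstr_wf (B : gstr) : Prop := {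
  gsrel_size : forall R (s : seq B), gsrel R s -> size s = rel_ar R;
  guard_refl : reflexive (@guard B);
  guard_sym : symmetric (@guard B);
  guard_fun : forall F (x y z : B), gfun F x y -> guard x z -> guard y z;
  gsrel_guard : forall R (s : seq B), gsrel R s -> {in s &, forall x y, guard x y};
  chart_fun : forall F a (y : B), gfun F (chart B a) y -> exists b, y = chart B b;
  chart_guard : forall a b, guard (chart B a) (chart B b)
}.

Record gaut (B : gstr) (l : lperm) (g : {perm B}) : Prop := {
  gaut_lang : lang_grp l;
  gaut_rel : forall R (s : seq B), gsrel R s <-> gsrel (l.1 R) (map g s);
  gaut_fun : forall F (x y : B), gfun F x y <-> gfun (l.2 F) (g x) (g y);
  gaut_guard : forall x y : B, guard (g x) (g y) = guard x y
}.

Definition in_copy (B : gstr) (Q : {set B}) : Prop :=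
  exists l g, gaut (B := B) l g /\ {in Q, forall x, exists a, x = g (chart B a)}.

Definition clique (B : gstr) (Q : {set B}) : Prop :=
  {in Q &, forall x y, guard x y}.

(** A local isomorphism: function values lift, while injectivity and reflection of relations are
    asked on guarded tuples only. *)
Record covering (B' B : gstr) (p : B' -> B) : Prop := {
  cov_fun : forall F x y, gfun F x y -> gfun F (p x) (p y);
  cov_fun_lift : forall F x y, gfun F (p x) y -> exists2 y', gfun F x y' & p y' = y;
  cov_guard : forall x y, guard x y -> guard (p x) (p y);
  cov_inj : forall x y, guard x y -> p x = p y -> x = y;
  cov_rel : forall R (s : seq B'), {in s &, forall x y, guard x y} ->
    (gsrel R s <-> gsrel R (map p s));
  cov_chart : forall a, p (chart B' a) = chart B a
}.

Lemma gaut_inv B l g : gaut (B := B) l g -> exists q, gaut (B := B) q (g^-1)%g.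
Proof.
case=> Gl gr gf gg; have [q Gq [lK1 qK1 lK2 qK2]] := lang_grpV Gl.
exists q; split=> // [R s|F x y|x y].
- by rewrite (gr (q.1 R)) qK1 -map_comp map_id_in // => x _; rewrite /= permKV.
- by rewrite (gf (q.2 F)) qK2 !permKV.
- by rewrite -gg !permKV.
Qed.

Lemma gaut_comp B l g l' h : gaut (B := B) l g -> gaut l' h ->
  gaut (B := B) (lcomp l' l) (g * h)%g.
Proof.
case=> Gl gr gf gg [Gl' hr hf hg]; split=> [|R s|F x y|x y].
- exact: lang_grpM.
- rewrite gr hr -map_comp; have -> // : map (h \o g) s = map (g * h)%g s.
  by apply: eq_map => x; rewrite permM.
- by rewrite gf hf !permM.
- by rewrite !permM hg gg.
Qed.

Lemma gaut1 B : gaut (B := B) (id, id) 1%g.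
Proof.
split=> [|R s|F x y|x y]; rewrite ?perm1 //; first exact: lang_grp1.
by rewrite map_id_in // => x _; rewrite perm1.
Qed.

Definition step (B : gstr) : rel B := fun x y => `[< exists F, gfun F x y >].
(** As functions are unary, this is the vertex set of the substructure generated by one vertex. *)
Definition cl (B : gstr) : rel B := connect (@step B).

Lemma cl_ind_rel (B : gstr) (P : B -> Prop) :
  (forall F x y, gfun F x y -> P x -> P y) -> forall x y, cl x y -> P x -> P y.
Proof.
move=> Pf x y /connectP[s]; elim: s x => [x _ -> //|z s IHs x /= /andP[]].
by move=> /asboolP[F xz] zs eqy Px; apply: (IHs z) => //; apply: Pf xz Px.
Qed.

Lemma cl_aut B l g x y : gaut (B := B) l g -> cl (g x) (g y) = cl x y.
Proof.
have clW l' h u v : gaut (B := B) l' h -> cl u v -> cl (h u) (h v).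
  move=> hA uv; have := connect0 (@step B) (h u).
  apply: (@cl_ind_rel B (fun w => cl (h u) (h w))) uv => F w z wz /connect_trans.
  apply; apply: connect1; apply/asboolP.
  by exists (l'.2 F); rewrite -(gaut_fun hA).
move=> gA; apply/idP/idP; last exact: clW gA.
by have [q /clW gA'] := gaut_inv gA => /gA'; rewrite !permK.
Qed.

End GuardedStructures.

(** * The lift of a guarded structure by valuations in [m] colours *)

Section Lift.
Variables (L : language) (A : Type) (B : gstr L A) (Bwf : gstr_wf B) (m : nat).
Implicit Types (x y z u v : B) (J : {set B * B}) (g h : {perm B}).

Definition pattern_act (g : {perm B}) J : {set B * B} :=
  [set q : B * B | ((g^-1)%g q.1, (g^-1)%g q.2) \in J]%SET.

Lemma mem_pattern_act g J u v :
  ((g u, g v) \in pattern_act g J) = ((u, v) \in J).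
Proof. by rewrite inE /= !permK. Qed.

Lemma pattern_actM g h J : pattern_act (g * h)%g J = pattern_act h (pattern_act g J).
Proof. by apply/setP => -[u v]; rewrite !inE /= invMg !permM. Qed.

Lemma pattern_actK g J : pattern_act (g^-1)%g (pattern_act g J) = J.
Proof.
by rewrite -pattern_actM mulgV; apply/setP => -[u v]; rewrite !inE invg1 !perm1.
Qed.

Lemma pattern_actKV g J : pattern_act g (pattern_act (g^-1)%g J) = J.
Proof.
by rewrite -pattern_actM mulVg; apply/setP => -[u v]; rewrite !inE invg1 !perm1.
Qed.

(* A pattern [J] asks for a colouring of its diagonal [{u | (u, u) \in J}] in
   which two vertices get the same colour exactly when [J] relates them. *)
Definition realized T (f : T -> B) J (c : B -> option 'I_m) : Prop :=
  (forall a, (f a, f a) \in J -> c (f a)) /\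
  (forall a b, (f a, f a) \in J -> (f b, f b) \in J ->
     (c (f a) == c (f b)) = ((f a, f b) \in J)).

(** Colourability is asked on all images of the chart under automorphisms, which makes feasibility
    invariant under automorphisms. *)
Definition feasible J : Prop :=
  (forall u v, ((u, v) \in J) = ((v, u) \in J)) /\
  (forall l g, gaut (B := B) l g -> exists c, realized (g \o chart B) J c).

Lemma feasible_act l g J : gaut (B := B) l g ->
  feasible J -> feasible (pattern_act g J).
Proof.
move=> gA [Js Jr]; split=> [u v|l' h hA]; first by rewrite !inE /= Js.
have [q gA'] := gaut_inv gA.
have [c [c1 c2]] := Jr _ _ (gaut_comp hA gA').
exists (c \o (g^-1)%g); split=> [a|a b] /=; have := c1; have := c2;
  rewrite !inE /= => c2' c1'.
  by move=> Ja; have := c1 a; rewrite /= permM; apply.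
by move=> Ja Jb; have := c2 a b; rewrite /= !permM; apply.
Qed.

Let feas J : bool := `[< feasible J >].

Lemma feas_act l g J : gaut (B := B) l g -> feas (pattern_act g J) = feas J.
Proof.
move=> gA; apply/asboolP/asboolP; last exact: feasible_act gA.
by have [q /feasible_act gA'] := gaut_inv gA => /gA'; rewrite pattern_actK.
Qed.

Definition valuation := {ffun B * {set B * B} -> option 'I_m}.
Implicit Types X Y : valuation.

Definition agree X Y : bool := `[< forall J u v i j,
  X (u, J) = Some i -> Y (v, J) = Some j -> (i == j) = ((u, v) \in J) >].

(** The valuation covers the whole closure of [x], so that restricting it to the closure of a
    function value of [x] gives a vertex over that value. *)
Definition supported x X : bool :=
  [forall q, isSome (X q) == [&& cl x q.1, (q.1, q.1) \in q.2 & feas q.2]].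

Definition valued (w : B * valuation) : bool :=
  supported w.1 w.2 && agree w.2 w.2.

Definition lvert : finType := {w : B * valuation | valued w}.
Definition LVert q (qV : valued q) : lvert := exist (fun q => valued q) q qV.
Definition proj (w : lvert) : B := (val w).1.
Definition vals (w : lvert) : valuation := (val w).2.
Implicit Types w t : lvert.

Lemma supportP w u J :
  isSome (vals w (u, J)) = [&& cl (proj w) u, (u, u) \in J & feas J].
Proof. by have /andP[/forallP/(_ (u, J))/eqP] := valP w. Qed.

Lemma agree_refl w : agree (vals w) (vals w).
Proof. by have /andP[] := valP w. Qed.

Definition lguard : rel lvert :=
  fun w t => guard (proj w) (proj t) && agree (vals w) (vals t).

Definition subval w t := forall q i, vals w q = Some i -> vals t q = Some i.

Definition lrel R (s : seq lvert) : Prop :=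
  gsrel R (map proj s) /\ {in s &, forall w t, lguard w t}.

Definition lfun F w t : Prop := gfun F (proj w) (proj t) /\ subval t w.

Lemma agreeC w t : agree (vals w) (vals t) -> agree (vals t) (vals w).
Proof.
move=> /asboolP wt; apply/asboolP => J u v i j ui vj.
rewrite eq_sym (wt _ _ _ _ _ vj ui).
have := supportP t u J; rewrite ui => /esym/and3P[_ _ /asboolP[Js _]].
exact: Js.
Qed.

(** Vertices with the same projection have the same support, and on the support [(u, u) \in J]
    forces their colours to be equal. *)
Lemma lguard_inj w t : lguard w t -> proj w = proj t -> w = t.
Proof.
move=> /andP[_ /asboolP wt] eqp; apply: val_inj; move: eqp.
have sP u J := (supportP w u J, supportP t u J).
rewrite /vals /proj in wt sP *; case: (val w) (val t) wt sP => x X [y Y] /= XY sP.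
move=> eqp; subst y; congr pair; apply/ffunP => -[u J].
have eqS : isSome (X (u, J)) = isSome (Y (u, J)) by rewrite (sP u J).1 (sP u J).2.
have := (sP u J).1; have := XY J u u; move: eqS.
case: (X (u, J)) (Y (u, J)) => [i|] [j|] //= _.
move=> /(_ i j erefl erefl) eij /esym/and3P[_ Ju _].
by apply/congr1/eqP; rewrite eij.
Qed.

Lemma restrict_valued w y : cl (proj w) y ->
  valued (y, [ffun q => if cl y q.1 then vals w q else None]).
Proof.
move=> wy; apply/andP; split=> /=.
  apply/forallP => -[u J] /=; rewrite ffunE /=; case: ifP => //= yu.
  by rewrite supportP; have -> : cl (proj w) u by apply: connect_trans wy yu.
apply/asboolP => J u v i j; rewrite !ffunE /=.
case: ifP => // _ ui; case: ifP => // _ vj.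
by have /asboolP := agree_refl w; apply; [exact: ui|exact: vj].
Qed.

Lemma lguard_fun F w t (z : lvert) : lfun F w t -> lguard w z -> lguard t z.
Proof.
move=> [wt st] /andP[wz /asboolP az]; apply/andP; split.
  exact: (guard_fun Bwf wt wz).
by apply/asboolP => J u v i j /st ui vj; apply: az ui vj.
Qed.

Lemma lguard_sym : symmetric lguard.
Proof.
by move=> w t; apply/idP/idP => /andP[g a]; rewrite /lguard guard_sym // g agreeC.
Qed.

Lemma lguard_refl : reflexive lguard.
Proof. by move=> w; rewrite /lguard guard_refl // agree_refl. Qed.

(** * Lifting the chart and defining the lifted guarded structure *)

Section Chart.
Variable c : {set B * B} -> B -> option 'I_m.
Hypothesis cP : forall J, feas J -> realized (chart B) J (c J).

Definition chart_val a : B * valuation :=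
  (chart B a, [ffun q : B * {set B * B} =>
    if [&& cl (chart B a) q.1, (q.1, q.1) \in q.2 & feas q.2]
    then c q.2 q.1 else None]).

Lemma cl_chart a u : cl (chart B a) u -> exists b, u = chart B b.
Proof.
move=> au; have : exists b, chart B a = chart B b by exists a.
apply: (@cl_ind_rel L A B (fun u => exists b, u = chart B b)) au => F x y xy [b eqx].
by apply: (chart_fun Bwf (F := F) (a := b)); rewrite -eqx.
Qed.

Lemma agree_chart a b : agree (chart_val a).2 (chart_val b).2.
Proof.
apply/asboolP => J u v i j; rewrite !ffunE /=.
case: ifP => // /and3P[/cl_chart[a' ->] Ja fJ] ci.
case: ifP => // /and3P[/cl_chart[b' ->] Jb _] cj.
by have [_ /(_ _ _ Ja Jb) <-] := cP fJ; rewrite ci cj.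
Qed.

Lemma chart_valued a : valued (chart_val a).
Proof.
apply/andP; split; last exact: agree_chart.
apply/forallP => -[u J] /=; rewrite ffunE /=; case: ifP => //.
by case/and3P => /cl_chart[b ->] Jb fJ; have [/(_ _ Jb) ->] := cP fJ.
Qed.

Definition lchart a : lvert := LVert (chart_valued a).

Definition lift_gstr : gstr L A := GStr lrel lfun lguard lchart.

Lemma lift_gstr_wf : gstr_wf lift_gstr.
Proof.
split.
- by move=> R s [/(gsrel_size Bwf) <- _]; rewrite size_map.
- exact: lguard_refl.
- exact: lguard_sym.
- exact: lguard_fun.
- by move=> R s [].
(* The value [w] lies over [chart B b]. It is guarded with [lchart b] because [lchart a] is, so the
   two coincide. *)
- move=> F a w aw; have [b eqw] := chart_fun Bwf aw.1.
  exists b; apply: lguard_inj => //.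
  apply: lguard_fun aw _; apply/andP; split; [exact: chart_guard|exact: agree_chart].
- by move=> a b; apply/andP; split; [exact: chart_guard|exact: agree_chart].
Qed.

Lemma lift_covering : covering (B' := lift_gstr) (B := B) proj.
Proof.
split=> //.
- by move=> F w t [].
(* The lifted value carries the valuation of [w] restricted to the closure of [y]. *)
- move=> F w y wy.
  have cwy : cl (proj w) y by apply: connect1; apply/asboolP; exists F.
  exists (LVert (restrict_valued cwy)) => //; split => // q i.
  by rewrite /vals /= ffunE; case: ifP.
- by move=> w t /andP[].
- exact: lguard_inj.
- by move=> R s sg; split=> [[]|].
Qed.

(** * Lifting an automorphism along with injections of the colours *)

Section LiftAut.
Variables (l : lperm L) (g : {perm B}) (gA : gaut (B := B) l g).
Variables (sigma : {set B * B} -> 'I_m -> 'I_m).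
Hypothesis sigma_inj : forall J, injective (sigma J).

(** The colour of [g u] in the translate of [J] is the image under [sigma J] of the colour of [u] in
    [J]; this is [theta_valE], and the inverses serve to write it as a function of the target. *)
Definition theta_val X : valuation :=
  [ffun q => omap (sigma (pattern_act (g^-1)%g q.2))
                  (X ((g^-1)%g q.1, pattern_act (g^-1)%g q.2))].

Lemma theta_valE X u J : theta_val X (g u, pattern_act g J) = omap (sigma J) (X (u, J)).
Proof. by rewrite ffunE /= permK pattern_actK. Qed.

Lemma pattern_actP (q : B * {set B * B}) : exists u J, q = (g u, pattern_act g J).
Proof.
exists ((g^-1)%g q.1), (pattern_act (g^-1)%g q.2).
by rewrite permKV pattern_actKV -surjective_pairing.
Qed.

Lemma omap_sigma J o i : omap (sigma J) o = Some i -> exists2 k, o = Some k & sigma J k = i.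
Proof. by case: o => //= k [<-]; exists k. Qed.

Lemma agree_theta X Y : agree (theta_val X) (theta_val Y) = agree X Y.
Proof.
apply/asboolP/asboolP => XY J u v i j.
  move=> ui vj; rewrite -(mem_pattern_act g) -(inj_eq (sigma_inj (J := J))).
  by apply: XY; rewrite theta_valE ?ui ?vj.
have [u' [J' [-> ->]]] := pattern_actP (u, J).
rewrite -[v](permKV g) mem_pattern_act !theta_valE.
move=> /omap_sigma[i' ui <-] /omap_sigma[j' vj <-].
by rewrite inj_eq //; apply: XY ui vj.
Qed.

Lemma supported_theta x X : supported x X -> supported (g x) (theta_val X).
Proof.
move=> /forallP sX; apply/forallP => q; have [u [J ->]] := pattern_actP q.
rewrite theta_valE /= (cl_aut _ _ gA) mem_pattern_act (feas_act _ gA).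
by have /eqP <- := sX (u, J) ; case: (X _).
Qed.

Lemma theta_valued w : valued (g (proj w), theta_val (vals w)).
Proof.
have /andP[sw aw] := valP w.
by apply/andP; split; [exact: supported_theta|rewrite /= agree_theta].
Qed.

Definition theta w : lvert := LVert (theta_valued w).

Lemma vals_theta w u J : vals (theta w) (g u, pattern_act g J) = omap (sigma J) (vals w (u, J)).
Proof. exact: theta_valE. Qed.

Lemma theta_guard w t : lguard (theta w) (theta t) = lguard w t.
Proof. by rewrite /lguard /= agree_theta (gaut_guard gA). Qed.

Lemma theta_inj : injective theta.
Proof.
move=> w t eqt; apply: lguard_inj; first by rewrite -theta_guard eqt lguard_refl.
by apply: (perm_inj (s := g)); apply: (congr1 proj eqt).
Qed.

Lemma theta_gaut : gaut (B := lift_gstr) l (perm theta_inj).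
Proof.
have pE s : map proj (map (perm theta_inj) s) = map g (map proj s).
  by rewrite -!map_comp; apply: eq_map => w /=; rewrite permE.
split=> /= [|R s|F w t|w t].
- exact: gaut_lang gA.
- split=> -[ps gs]; split.
  + by rewrite pE -(gaut_rel gA).
  + by move=> _ _ /mapP[w ws ->] /mapP[t ts ->]; rewrite !permE theta_guard gs.
  + by move: ps; rewrite pE -(gaut_rel gA).
  + move=> w t ws ts; move: (gs _ _ (map_f _ ws) (map_f _ ts)).
    by rewrite !permE theta_guard.
- rewrite !permE; have [gf gf'] := gaut_fun gA F (proj w) (proj t).
  split=> -[wt st]; (split; first by [apply: gf|apply: gf']).
  + move=> q i; have [u [J ->]] := pattern_actP q.
    by rewrite !vals_theta => /omap_sigma[j /st -> <-].
  + move=> [u J] i ui; have := st (g u, pattern_act g J) (sigma J i).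
    by rewrite !vals_theta ui => /(_ erefl)/omap_sigma[j -> /sigma_inj ->].
- by rewrite !permE theta_guard.
Qed.

End LiftAut.

(** * Colour permutations that make a lifted automorphism extend a given partial map [G] over [g] *)

Section Extend.
Variables (l : lperm L) (g : {perm B}) (gA : gaut (B := B) l g).
Variable G : lvert -> lvert -> Prop.
Hypothesis G_dom : forall w w' t t', G w t -> G w' t' -> lguard w w'.
Hypothesis G_ran : forall w w' t t', G w t -> G w' t' -> lguard t t'.
Hypothesis G_proj : forall w t, G w t -> proj t = g (proj w).

Definition recolor J : rel 'I_m := fun i j => `[< exists w t u,
  [/\ G w t, vals w (u, J) = Some i & vals t (g u, pattern_act g J) = Some j] >].

(** Equality of two colours is dictated by [J] in the domain and by the translate of [J] in the
    range, since both are cliques of the guard. *)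
Lemma recolor_inj J : partial_inj (recolor J).
Proof.
move=> i j i' j' /asboolP[w [t [u [Gwt wi tj]]]] /asboolP[w' [t' [u' [Gwt' wi' tj']]]].
have /andP[_ /asboolP aw] := G_dom Gwt Gwt'.
have /andP[_ /asboolP awt] := G_ran Gwt Gwt'.
by rewrite (aw _ _ _ _ _ wi wi') (awt _ _ _ _ _ tj tj') mem_pattern_act.
Qed.

Lemma supp_transfer w t u J : proj t = g (proj w) ->
  isSome (vals t (g u, pattern_act g J)) = isSome (vals w (u, J)).
Proof.
by move=> eqt; rewrite !supportP eqt (cl_aut _ _ gA) mem_pattern_act (feas_act _ gA).
Qed.

Lemma theta_extend w t : G w t ->
  theta gA (fun J => pext_inj (@recolor_inj J)) w = t.
Proof.
move=> Gwt; apply: val_inj; apply/eqP; rewrite -pair_eqE /=.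
rewrite -[(val t).1]/(proj t) (G_proj Gwt) eqxx /=; apply/eqP/ffunP => q.
have [u [J ->]] := pattern_actP g q; rewrite theta_valE.
have := supp_transfer u J (G_proj Gwt); rewrite -/(vals t).
case wi: (vals w (u, J)) => [i|]; case tj: (vals t _) => [j|] //= _.
congr Some; apply: pextE; first exact: recolor_inj.
by apply/asboolP; exists w, t, u.
Qed.

End Extend.
End Chart.

Lemma chart_coloring : exists c : {set B * B} -> B -> option 'I_m,
  forall J, feas J -> realized (chart B) J (c J).
Proof.
have /choice[c cP] : forall J, exists c : B -> option 'I_m,
    feas J -> realized (chart B) J c.
  move=> J; case fJ: (feas J); last by exists (fun _ => None).
  have /asboolP[_ /(_ _ _ (gaut1 B))[c [c1 c2]]] := fJ.
  exists c => _; split=> [a|a b]; move: (c1 a) ; rewrite /= perm1 //.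
  by move=> _; move: (c2 a b); rewrite /= !perm1.
by exists c.
Qed.

End Lift.

(** * One step of the tower of lifts *)

Section Stage.
Variables (L : language) (A Idx : Type).
Variables (lang : Idx -> lperm L) (prel : Idx -> A -> A -> Prop).

(** [Idx] stands for the partial automorphisms, with language part [lang i] and graph [prel i] on
    [A]; it does not depend on [B], so extensions can be carried from one level to the next. *)
Definition extending (B : gstr L A) (hat : Idx -> {perm B}) : Prop :=
  forall i, gaut (B := B) (lang i) (hat i) /\
    forall a b, prel i a b -> hat i (chart B a) = chart B b.

Definition composite i j k : Prop :=
  [/\ lang k = lcomp (lang j) (lang i),
      forall a c, prel k a c <-> exists2 b, prel i a b & prel j b c &
      forall b, (exists a, prel i a b) <-> (exists c, prel j b c)].

Definition functorial (B : gstr L A) (hat : Idx -> {perm B}) : Prop :=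
  forall i j k, composite i j k -> forall x, hat k x = hat j (hat i x).

(** This is all that is used later about the colours: a feasible pattern pulls back to one that is
    colourable along guarded pairs. *)
Definition colors_feasible m (B' B : gstr L A) (p : B' -> B) : Prop :=
  forall J : {set B * B}, feasible m J -> exists c : B' -> option 'I_m,
    (forall x, (p x, p x) \in J -> c x) /\
    (forall x y, guard x y -> (p x, p x) \in J -> (p y, p y) \in J ->
       (c x == c y) = ((p x, p y) \in J)).

Lemma stage_step m (B : gstr L A) (hat : Idx -> {perm B}) :
  gstr_wf B -> extending hat ->
  exists (B' : gstr L A) (p : B' -> B) (hat' : Idx -> {perm B'}),
    [/\ gstr_wf B', covering p & extending hat'] /\
    [/\ functorial hat -> functorial hat',
        forall Q : {set B'}, clique Q -> in_copy (p @: Q) -> in_copy Q &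
        colors_feasible m p].
Proof.
move=> Bwf hatP; have [c cP] := chart_coloring B m.
pose B' := lift_gstr Bwf cP.
have B'wf : gstr_wf B' := lift_gstr_wf Bwf cP.
(* The partial map [prel i], transported to the lifted chart. *)
pose G i (w t : lvert B m) : Prop := exists a b,
  [/\ prel i a b, w = lchart Bwf cP a & t = lchart Bwf cP b].
have G_dom i w w' t t' : G i w t -> G i w' t' -> lguard w w'.
  by move=> [a [_ [_ -> _]]] [a' [_ [_ -> _]]]; apply: (chart_guard B'wf).
have G_ran i w w' t t' : G i w t -> G i w' t' -> lguard t t'.
  by move=> [_ [a [_ _ ->]]] [_ [a' [_ _ ->]]]; apply: (chart_guard B'wf).
have G_proj i w t : G i w t -> proj t = hat i (proj w).
  by move=> [a [b [iab -> ->]]]; apply/esym; have [_] := hatP i; apply.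
have gA i : gaut (B := B) (lang i) (hat i) by have [] := hatP i.
pose r i J := recolor (hat i) (G i) J.
have rP i J : partial_inj (r i J).
  exact: (recolor_inj (@G_dom i) (@G_ran i)).
pose th i := theta (gA i) (fun J => pext_inj (rP i J)).
have thG i w t : G i w t -> th i w = t.
  move=> Gwt; rewrite -[RHS](theta_extend (gA i) (@G_dom i) (@G_ran i) (@G_proj i) Gwt).
  by apply: val_inj.
exists B', (@proj _ _ B m);
exists (fun i => perm (@theta_inj _ _ _ Bwf _ _ _ (gA i) _ (fun J => pext_inj (rP i J)))).
split; first split=> //; first exact: lift_covering.
  move=> i; split; first exact: theta_gaut.
  by move=> a b iab; rewrite permE; apply: thG; exists a, b.
split.
- move=> hatF i j k ijk w; rewrite !permE; have [lk kE ij] := ijk.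
  have hk := hatF _ _ _ ijk.
  apply: val_inj; rewrite /= /proj /= hk; congr pair; apply/ffunP => q.
  have [u [J ->]] := pattern_actP (hat k) q; rewrite theta_valE.
  have -> : pattern_act (hat k) J = pattern_act (hat j) (pattern_act (hat i) J).
    rewrite -pattern_actM; congr pattern_act.
    by apply/permP => x; rewrite permM hk.
  rewrite hk /vals /= !theta_valE; case: ((val w).2 _) => //= v; congr Some.
  (* It remains to see that the recolouring of [k] is the composite of those of [i] and [j], with
     matching range and domain. A vertex and its image over an automorphism have corresponding
     supports, so the intermediate colours exist. *)
  apply: pext_comp => // [v1 v3|v2].
  + split.
    * move=> /asboolP[_ [_ [u' [[a [d [kad -> ->]]] e1 e3]]]].
      have /kE[b iab jbd] := kad.
      have Gab : G i (lchart Bwf cP a) (lchart Bwf cP b) by exists a, b.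
      have := supp_transfer (gA i) u' J (G_proj _ _ _ Gab); rewrite e1.
      case e2 : (vals _ _) => [v2|] // _; exists v2; apply/asboolP.
        by exists (lchart Bwf cP a), (lchart Bwf cP b), u'.
      exists (lchart Bwf cP b), (lchart Bwf cP d), (hat i u'); split=> //.
        by exists b, d.
      rewrite -e3 hk -pattern_actM; congr (vals _ (_, pattern_act _ J)).
      by apply/permP => x; rewrite permM hk.
    * move=> [v2 /asboolP[_ [_ [u' [[a [b [iab -> ->]]] e1 e2]]]] r23].
      (* The witnesses of [r23] need not involve [b]. Instead an image [d] of [b] supplies a colour,
         which equals [v3] because recolouring is functional. *)
      have [d jbd] : exists d, prel j b d by apply/ij; exists a.
      have Gbd : G j (lchart Bwf cP b) (lchart Bwf cP d) by exists b, d.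
      have := supp_transfer (gA j) (hat i u') (pattern_act (hat i) J) (G_proj _ _ _ Gbd).
      rewrite e2; case e3 : (vals _ _) => [v3'|] // _.
      have r23' : r j (pattern_act (hat i) J) v2 v3'.
        by apply/asboolP; exists (lchart Bwf cP b), (lchart Bwf cP d), (hat i u').
      have /esym := rP _ _ _ _ _ _ r23 r23'; rewrite eqxx => /eqP eqv; subst v3'.
      apply/asboolP; exists (lchart Bwf cP a), (lchart Bwf cP d), u'; split=> //.
        by exists a, d; split=> //; apply/kE; exists b.
      rewrite -e3 hk -pattern_actM; congr (vals _ (_, pattern_act _ J)).
      by apply/permP => x; rewrite permM hk.
  + apply/existsP/existsP => -[].
    * move=> v1 /asboolP[_ [_ [u' [[a [b [iab -> ->]]] e1 e2]]]].
      have [d jbd] : exists d, prel j b d by apply/ij; exists a.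
      have Gbd : G j (lchart Bwf cP b) (lchart Bwf cP d) by exists b, d.
      have := supp_transfer (gA j) (hat i u') (pattern_act (hat i) J) (G_proj _ _ _ Gbd).
      rewrite e2; case e3 : (vals _ _) => [v3|] // _; exists v3; apply/asboolP.
      by exists (lchart Bwf cP b), (lchart Bwf cP d), (hat i u').
    * move=> v3 /asboolP[_ [_ [u' [[b [d [jbd -> ->]]] e2 e3]]]].
      have [a iab] : exists a, prel i a b by apply/ij; exists d.
      have Gab : G i (lchart Bwf cP a) (lchart Bwf cP b) by exists a, b.
      have := supp_transfer (gA i) ((hat i)^-1%g u') J (G_proj _ _ _ Gab).
      rewrite permKV e2; case e1 : (vals _ _) => [v1|] // _; exists v1; apply/asboolP.
      exists (lchart Bwf cP a), (lchart Bwf cP b), ((hat i)^-1%g u').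
      by split=> //; rewrite permKV.
- move=> Q cQ [l [g [gAut gQ]]].
  (* A chart vertex is matched with the element of [Q] that lies over its translate by [g]. Chart
     and [Q] are both cliques, so some lift of [g] extends this matching. *)
  pose GQ (w t : lvert B m) : Prop := exists a,
    [/\ w = lchart Bwf cP a, t \in Q & proj t = g (chart B a)].
  have GQ_dom w w' t t' : GQ w t -> GQ w' t' -> lguard w w'.
    by move=> [a [-> _ _]] [a' [-> _ _]]; apply: (chart_guard B'wf).
  have GQ_ran w w' t t' : GQ w t -> GQ w' t' -> lguard t t'.
    by move=> [_ [_ tQ _]] [_ [_ tQ' _]]; apply: cQ.
  have GQ_proj w t : GQ w t -> proj t = g (proj w) by move=> [a [-> _ ->]].
  pose sQ J := pext_inj (@recolor_inj _ _ _ _ _ _ GQ_dom GQ_ran J).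
  exists l, (perm (@theta_inj _ _ _ Bwf _ _ _ gAut _ (sQ g))); split; first exact: theta_gaut.
  move=> t tQ; have [|a eqt] := gQ (proj t); first exact: imset_f.
  exists a; rewrite permE; apply/esym/(theta_extend gAut GQ_dom GQ_ran GQ_proj).
  by exists a.
(* Every vertex colours itself: its valuation is read at its own projection, and agreement of
   guarded vertices is exactly the condition of the pattern. *)
- move=> J fJ; exists (fun w => vals w (proj w, J)); split=> [w Jw|w t wt Jw Jt].
    by rewrite supportP Jw /cl connect0 /=; apply/asboolP.
  have := supportP w (proj w) J; have := supportP t (proj t) J.
  rewrite Jw Jt /cl !connect0 /=; have -> : `[< feasible m J >] by apply/asboolP.
  have /andP[_ /asboolP awt] := wt.
  have := awt J (proj w) (proj t).
  case: (vals w _) (vals t _) => [i|] [j|] //= awt' _ _.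
  by rewrite -(awt' i j).
Qed.

End Stage.

(** * Cliques and separators *)

Section Coverings.
Variables (L : language) (A : Type).
Implicit Types B : gstr L A.

Lemma covering_comp B1 B2 B3 (p : B1 -> B2) (q : B2 -> B3) :
  covering p -> covering q -> covering (q \o p).
Proof.
move=> pC qC; split=> /=.
- by move=> F x y /(cov_fun pC)/(cov_fun qC).
- move=> F x z /(cov_fun_lift qC)[y /(cov_fun_lift pC)[w xw <-] <-].
  by exists w.
- by move=> x y /(cov_guard pC)/(cov_guard qC).
- move=> x y xy /(cov_inj qC) eqp; apply: (cov_inj pC xy); apply: eqp.
  exact: (cov_guard pC).
- move=> R s sg; rewrite (cov_rel pC R sg) map_comp; apply: (cov_rel qC) => x y.
  by move=> /mapP[x' xs ->] /mapP[y' ys ->]; apply: (cov_guard pC); apply: sg.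
- by move=> a; rewrite (cov_chart pC) (cov_chart qC).
Qed.

Lemma covering_clique B1 B2 (p : B1 -> B2) (Q : {set B1}) :
  covering p -> clique Q -> clique (p @: Q).
Proof.
move=> pC cQ x y /imsetP[x' xQ ->] /imsetP[y' yQ ->].
exact/(cov_guard pC)/cQ.
Qed.

Lemma covering_clique_inj B1 B2 (p : B1 -> B2) (Q : {set B1}) :
  covering p -> clique Q -> {in Q &, injective p}.
Proof. by move=> pC cQ x y xQ yQ; apply: (cov_inj pC); apply: cQ. Qed.

Definition small_cliques_in_copies j B : Prop :=
  forall Q : {set B}, clique Q -> #|Q| <= j -> in_copy Q.

Definition cliques_in_copies B : Prop := forall Q : {set B}, clique Q -> in_copy Q.

(** This pattern asks for pairwise distinct colours on [Q]. A copy misses some element of [Q], so it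
    meets [Q] in at most [m] elements, which are coloured by their index. *)
Lemma diag_feasible B m (Q : {set B}) : #|Q| <= m.+1 -> ~ in_copy Q ->
  feasible m [set q : B * B | (q.1 == q.2) && (q.1 \in Q)]%SET.
Proof.
move=> Qm Qnc; split=> [u v|l g gA].
  by rewrite !inE /= [v == u]eq_sym; have [->|] := eqVneq u v.
pose X := [set x in Q | `[< exists a, x = g (chart B a) >]]%SET.
have Xm : #|X| <= m.
  rewrite -ltnS; apply: leq_trans Qm; apply/proper_card/properP; split.
    by apply/fintype.subsetP => x; rewrite inE => /andP[].
  apply: contrapT => QX; apply: Qnc; exists l, g; split=> // x xQ.
  apply: contrapT => xg; apply: QX; exists x => //.
  by rewrite inE xQ; apply/asboolPn.
have Xi x : x \in X -> index x (enum X) < m.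
  by move=> xX; apply: leq_trans Xm; rewrite cardE index_mem mem_enum.
have gX a : g (chart B a) \in Q -> g (chart B a) \in X.
  by move=> aQ; rewrite inE aQ; apply/asboolP; exists a.
exists (fun x => insub (index x (enum X))); split=> [a|a b] /=; rewrite !inE !eqxx /=.
  by move=> /gX/Xi am; rewrite insubT.
move=> aQ bQ; rewrite aQ andbT (insubT (fun k => k < m) (Xi _ (gX _ aQ))).
rewrite (insubT (fun k => k < m) (Xi _ (gX _ bQ))) -[LHS]val_eqE /=.
apply/eqP/eqP => [[eqi]|-> //].
have nX b' := nth_index (g (chart B a)) (s := enum X) (x := g (chart B b')).
by rewrite -(nX a) ?eqi ?nX ?mem_enum ?gX.
Qed.

(* With only [m] colours, the diagonal of a clique of size [m.+1] cannot be
   coloured injectively, so every such clique gets destroyed unless it already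
   lies in a copy. *)
Lemma small_cliques_step m B' B (p : B' -> B) : covering p ->
  (forall Q : {set B'}, clique Q -> in_copy (p @: Q) -> in_copy Q) ->
  colors_feasible m p ->
  small_cliques_in_copies m B -> small_cliques_in_copies m.+1 B'.
Proof.
move=> pC pL pF Bm Q cQ; rewrite leq_eqVlt ltnS => /predU1P[Qm|Qm]; last first.
  apply: pL => //; apply: Bm; first exact: covering_clique.
  by rewrite card_in_imset //; exact: covering_clique_inj.
apply: contrapT => Qnc.
have pQnc : ~ in_copy (p @: Q) by move=> /pL-/(_ cQ).
have pQm : #|p @: Q| <= m.+1.
  by rewrite card_in_imset ?Qm //; exact: covering_clique_inj.
have [c [c1 c2]] := pF _ (diag_feasible pQm pQnc).
have diagE x y : x \in Q ->
    ((p x, p y) \in [set q : B * B | (q.1 == q.2) && (q.1 \in p @: Q)]%SET) = (p x == p y).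
  by move=> xQ; rewrite inE /= (imset_f p xQ) andbT.
have cinj : {in Q &, injective c}.
  move=> x y xQ yQ eqc; have := c2 x y (cQ _ _ xQ yQ).
  rewrite !diagE // eqc !eqxx => /(_ isT isT)/esym/eqP eqp.
  exact: (covering_clique_inj pC cQ).
have : #|c @: Q| <= #|(Some @: [set: 'I_m])%SET|.
  apply/subset_leq_card/fintype.subsetP => _ /imsetP[x xQ ->].
  have := c1 x; rewrite diagE // eqxx => /(_ isT).
  by case: (c x) => // i _; rewrite imset_f ?inE.
by rewrite card_in_imset // Qm card_imset ?cardsT ?card_ord ?ltnn //; apply: Some_inj.
Qed.

Definition closed_in B (S : {set B}) : Prop :=
  forall F x y, x \in S -> gfun F x y -> y \in S.

Definition unguarded B (S : {set B}) : {set B * B} :=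
  [set q : B * B | [&& q.1 \in S, q.2 \in S & ~~ guard q.1 q.2]]%SET.

Lemma closed_imset B' B (p : B' -> B) (S : {set B'}) :
  covering p -> closed_in S -> closed_in (p @: S).
Proof.
move=> pC cS F _ y /imsetP[x xS ->] /(cov_fun_lift pC)[z xz <-].
exact/imset_f/(cS _ _ _ xS xz).
Qed.

(** Guards are preserved by [p], so every unguarded pair of the image comes from an unguarded pair
    of [S], and the pair [(x, y)] is not among these. *)
Lemma unguarded_drop B' B (p : B' -> B) (S : {set B'}) x y : covering p ->
  x \in S -> y \in S -> guard (p x) (p y) -> ~~ guard x y ->
  #|unguarded (p @: S)| < #|unguarded S|.
Proof.
move=> pC xS yS pxy xy.
rewrite [X in _ < X](cardsD1 (x, y)) inE /= xS yS xy add1n ltnS.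
apply: leq_trans (leq_imset_card (fun q => (p q.1, p q.2)) _).
apply/subset_leq_card/fintype.subsetP => -[u v]; rewrite inE /=.
move=> /and3P[/imsetP[u' uS ->] /imsetP[v' vS ->] uv].
apply/imsetP; exists (u', v') => //; rewrite !inE /= uS vS.
have uv' : ~~ guard u' v' by apply: contra uv; apply: (cov_guard pC).
rewrite uv' /= andbT; apply: contra uv => /eqP[-> ->].
exact: pxy.
Qed.

(** * Separating two unguarded vertices by a clique *)

Section Separation.
Variables (B' B : gstr L A) (p : B' -> B).
Hypotheses (Bwf : gstr_wf B) (pF : colors_feasible 2 p).
Variable S' : {set B'}.
Hypothesis S'g : {in S' &, forall x y, guard (p x) (p y) -> guard x y}.
Variable S : {set B}.
Hypotheses (SS' : S \subset p @: S') (Scl : closed_in S).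
Variables u v : B.
Hypotheses (uS : u \in S) (vS : v \in S) (uv : ~~ guard u v).

Let guardC (x y : B) : guard x y = guard y x.
Proof. exact: guard_sym. Qed.

(** A section of [p] over [S] with values in [S'] keeps guarded pairs guarded by [S'g], so the
    colouring upstairs can be pulled back along it. *)
Lemma lifted_coloring J : feasible 2 J -> exists c : B -> option 'I_2,
  {in S &, forall x y, guard x y -> (x, x) \in J -> (y, y) \in J ->
    (c x == c y) = ((x, y) \in J)}.
Proof.
move=> /pF[c [_ cP]].
have /choice[s sP] : forall x, exists x', x \in S -> x' \in S' /\ p x' = x.
  move=> x; have [xS|xS] := boolP (x \in S).
    by have /imsetP[x' xS' ->] := fintype.subsetP SS' x xS; exists x'.
  by have /imsetP[x' _ _] := fintype.subsetP SS' u uS; exists x'.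
exists (c \o s) => x y xS yS xy; have [sx px] := sP x xS; have [sy py] := sP y yS.
have := cP (s x) (s y); rewrite px py; apply.
by apply: S'g; rewrite ?px ?py.
Qed.

(* [side] is the component of [v] after the closed neighbourhood of [u] has
   been removed, and [sep] consists of its neighbours; every vertex of [sep] is
   adjacent to [u] and to [side]. *)
Let e : rel B := fun x y =>
  [&& guard x y, x \in S, y \in S, ~~ guard u x & ~~ guard u y].
Let side : {set B} := [set x | connect e v x]%SET.
Let sep : {set B} := [set z in S | (z \notin side) && [exists d in side, guard z d]]%SET.

Lemma sideP x : x \in side -> (x \in S) && ~~ guard u x.
Proof.
rewrite inE => /connectP[s]; elim: s v vS uv => [|z s IHs] w wS uw /=.
  by move=> _ ->; rewrite wS.
by move=> /andP[/and5P[_ _ zS _ uz]]; apply: IHs.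
Qed.

Lemma side_next x y : x \in side -> y \in S -> guard x y -> ~~ guard u y -> y \in side.
Proof.
move=> xD yS xy uy; have /andP[xS ux] := sideP xD; move: xD; rewrite !inE => vx.
by apply: connect_trans vx (connect1 _); rewrite /e xy xS yS ux uy.
Qed.

(** A vertex of [S] outside [side] with a neighbour in [side] must be guarded with [u], since
    otherwise [side] would reach it. *)
Lemma sepP z : z \in sep ->
  [/\ z \in S, z \notin side, guard u z & exists2 d, d \in side & guard z d].
Proof.
rewrite inE => /and3P[zS zD /existsP[d /andP[dD zd]]]; split=> //; last by exists d.
by apply: contraNT zD => uz; apply: (side_next dD zS) => //; rewrite guardC.
Qed.

Lemma mem_sep z d : z \in S -> z \notin side -> d \in side -> guard z d -> z \in sep.
Proof. by move=> zS zD dD zd; rewrite inE zS zD; apply/existsP; exists d; rewrite dD. Qed.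

(* If [a] and [b] were not adjacent, the pattern in which only the pair [a, u]
   gets distinct colours would be feasible, but it is inconsistent along the
   closed walk from [a] through [side] to [b] and back through [u]. *)
Lemma sep_clique : clique sep.
Proof.
move=> a b aZ bZ; have [aS aD ua [da daD ada]] := sepP aZ.
have [bS bD ub [db dbD bdb]] := sepP bZ.
case ab: (guard a b) => //; exfalso.
have uD : u \notin side by apply: contraT => /negPn/sideP; rewrite guard_refl // andbF.
have au : a != u by apply: contraTneq ada => ->; have /andP[] := sideP daD.
have bu : b != u by apply: contraTneq bdb => ->; have /andP[] := sideP dbD.
have ba : b != a by apply: contraFneq ab => ->; rewrite guard_refl.
pose I : {set B} := [set u; a; b]%SET :|: side.
pose J : {set B * B} := [set q | [&& q.1 \in I, q.2 \in I,
  ~~ ((q.1 == a) && (q.2 == u)) & ~~ ((q.1 == u) && (q.2 == a))]]%SET.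
have memI x : (x \in I) = [|| x == u, x == a, x == b | x \in side].
  by rewrite !finset.in_setU !finset.in_set1 -!orbA.
have memJ x y : ((x, y) \in J) = [&& x \in I, y \in I,
    ~~ ((x == a) && (y == u)) & ~~ ((x == u) && (y == a))] by rewrite finset.in_set.
have diagJ x : ((x, x) \in J) = (x \in I).
  rewrite memJ andbA andbb; have [->|] := eqVneq x a; last by rewrite andbF andbT.
  by rewrite (negbTE au) /= andbT.
have uI : u \in I by rewrite memI eqxx.
have aI : a \in I by rewrite memI eqxx orbT.
have bI : b \in I by rewrite memI eqxx !orbT.
have DI x : x \in side -> x \in I by rewrite memI => ->; rewrite !orbT.
have fJ : feasible 2 J.
  split=> [x y|l g gA].
    rewrite !memJ; case: (x \in I); case: (y \in I) => //=.
    by rewrite andbC (andbC (y == u)) (andbC (y == a)).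
  pose inW x := exists i, x = g (chart B i).
  have Wc x y : inW x -> inW y -> guard x y.
    by move=> [i ->] [j ->]; rewrite (gaut_guard gA); apply: chart_guard.
  (* If the copy misses [u], one colour suffices. If it contains [u], it avoids [side], whose
     vertices are not guarded with [u], and it does not contain both [a] and [b]; then [a] alone
     gets the second colour. *)
  exists (fun x => Some (inord ((x == a) && `[< inW u >]))); split=> // i j.
  rewrite !diagJ /=; set x := g (chart B i); set y := g (chart B j).
  have xW : inW x by exists i.
  have yW : inW y by exists j.
  have inordE (b1 b2 : bool) : (Some (inord b1 : 'I_2) == Some (inord b2)) = (b1 == b2).
    by rewrite -[LHS]val_eqE; case: b1 b2 => [] []; apply/eqP => //=;
      rewrite ?inordK // => -[] /(congr1 val); rewrite /= !inordK.
  move=> xI yI; rewrite inordE memJ xI yI /=.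
  have [uW|uW] := pselect (inW u); last first.
    rewrite (asboolF uW) !andbF eqxx; apply/esym.
    have xu : x != u by apply/eqP => xu; apply: uW; rewrite -xu.
    have yu : y != u by apply/eqP => yu; apply: uW; rewrite -yu.
    by rewrite (negbTE xu) (negbTE yu) andbF.
  rewrite (asboolT uW) !andbT.
  have near z : inW z -> z \in I -> [|| z == u, z == a | z == b].
    move=> zW; rewrite memI => /or4P[->|->|->|/sideP/andP[_]]; rewrite ?orbT //.
    by rewrite Wc.
  have nab : ~ (inW a /\ inW b) by move=> [aW bW]; rewrite Wc in ab.
  have bu' : (u == b) = false by rewrite eq_sym (negbTE bu).
  have au' : (u == a) = false by rewrite eq_sym (negbTE au).
  have [/or3P nx /or3P ny] := (near x xW xI, near y yW yI).
  case: nx => /eqP eqx; case: ny => /eqP eqy; rewrite eqx eqy ?eqxx ?au' ?bu'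
    ?(negbTE ba) ?(negbTE bu) ?(negbTE au) //; case: nab; rewrite -eqx -eqy //.
have [c cP] := lifted_coloring fJ.
have cE x y : x \in S -> y \in S -> x \in I -> y \in I -> guard x y ->
    ~~ ((x == a) && (y == u)) -> ~~ ((x == u) && (y == a)) -> c x = c y.
  move=> xS yS xI yI xy n1 n2; apply/eqP; rewrite cP ?diagJ //.
  by rewrite memJ xI yI n1 n2.
have nD x y : x \in side -> y \in [set a; u]%SET -> (x == y) = false.
  move=> xD; rewrite !finset.in_set2 => /orP[] /eqP ->; apply: contraTF xD => /eqP -> //.
have nDa x : x \in side -> (x == a) = false by move/nD; apply; rewrite finset.in_set2 eqxx.
have nDu x : x \in side -> (x == u) = false by move/nD; apply; rewrite finset.in_set2 eqxx orbT.
(* Colours are constant along [side], hence equal at [a], [da], [db], [b] and [u]. *)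
have cpath s w : w \in side -> path e w s -> c (last w s) = c w.
  elim: s w => //= y s IHs w wD /andP[/and5P[gwy wS yS _ uy] es].
  have yD : y \in side by apply: (side_next wD yS gwy uy).
  by rewrite IHs //; apply/esym/cE; rewrite ?DI ?nDa ?nDu.
have vD : v \in side by rewrite finset.in_set connect0.
have cD x : x \in side -> c x = c v.
  by rewrite finset.in_set => /connectP[s es ->]; apply: cpath.
have cda : c a = c da.
  have /andP[daS _] := sideP daD.
  by apply: cE; rewrite ?(DI _ daD) ?(nDa _ daD) ?(nDu _ daD) ?andbF.
have cdb : c b = c db.
  have /andP[dbS _] := sideP dbD.
  by apply: cE; rewrite ?(DI _ dbD) ?(nDa _ dbD) ?(nDu _ dbD) ?andbF.
have cub : c u = c b.
  by apply: cE; rewrite // ?(negbTE ba) ?(eq_sym u a) ?(negbTE au) ?andbF.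
(* The guarded pair of [a] and [u] has equal colours, although [J] demands distinct ones. *)
have := cP a u aS uS; rewrite guardC ua !diagJ aI uI => /(_ isT isT isT).
rewrite cub cdb cda !cD // eqxx => /esym.
by rewrite memJ !eqxx /= !andbF.
Qed.

(** The parts are [side :|: sep], which misses [u], and [S] without [side], which misses [v]; they
    meet in [sep]. Both are closed because a function value of [x] is guarded with [x] and with
    everything that [x] is guarded with. *)
Lemma separation : exists S1 S2 : {set B},
  [/\ S = S1 :|: S2, closed_in S1, closed_in S2, clique (S1 :&: S2) &
      [/\ S1 \proper S, S2 \proper S &
          forall x y, x \in S1 -> x \notin S2 -> y \in S2 -> y \notin S1 ->
            ~~ guard x y]].
Proof.
have DS x : x \in side -> x \in S by case/sideP/andP.
have vD : v \in side by rewrite inE connect0.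
have uD : u \notin side.
  by apply: contraT => /negPn/sideP; rewrite guard_refl // andbF.
have uZ : u \notin sep.
  by apply/negP => /sepP[_ _ _ [d /sideP/andP[_ /negbTE ->]]].
have fun_guard F (x y : B) : gfun F x y -> guard x y.
  by move=> xy; rewrite guardC (guard_fun Bwf xy) ?guard_refl.
exists (side :|: sep), (S :\: side)%SET; split.
- apply/setP => x; rewrite finset.in_setU finset.in_setU finset.in_setD.
  case xD: (x \in side) => /=; first exact: DS.
  by case xZ: (x \in sep) => //=; have [] := sepP xZ.
- move=> F x y; rewrite !finset.in_setU => /orP[xD|xZ] xy.
    have yS : y \in S by apply: Scl xy; apply: DS.
    case yD: (y \in side) => //=; apply: (mem_sep yS _ xD); rewrite ?yD //.
    by rewrite guardC (fun_guard _ _ _ xy).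
  have [xS xD _ [d dD xd]] := sepP xZ.
  case yD: (y \in side) => //=; apply: (mem_sep _ _ dD); rewrite ?yD //.
    exact: Scl xy.
  exact: guard_fun xy xd.
- move=> F x y; rewrite !finset.in_setD => /andP[xD xS] xy.
  rewrite (Scl xS xy) andbT; apply/negP => yD.
  have xZ : x \in sep by apply: mem_sep yD _ => //; apply: fun_guard xy.
  have [_ _ ux _] := sepP xZ.
  have /andP[_ /negP] := sideP yD; apply.
  by rewrite guardC; apply: (guard_fun Bwf xy); rewrite guardC.
- move=> x y; rewrite !finset.in_setI !finset.in_setU !finset.in_setD.
  move=> /andP[xDZ /andP[xD _]] /andP[yDZ /andP[yD _]].
  move: xDZ yDZ; rewrite (negbTE xD) (negbTE yD) /=; exact: sep_clique.
- split.
  + apply/properP; split; last by exists u; rewrite // finset.in_setU negb_or uD.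
    apply/fintype.subsetP => x; rewrite finset.in_setU => /orP[/DS //|/sepP[]//].
  + apply/properP; split; last by exists v; rewrite // finset.in_setD vD.
    by apply/fintype.subsetP => x; rewrite finset.in_setD => /andP[].
  + move=> x y; rewrite !finset.in_setU !finset.in_setD => /orP[xD|xZ].
      move=> _ /andP[yD yS]; rewrite (negbTE yD) /=; apply: contra => xy.
      by apply: mem_sep xD _ => //; rewrite guardC.
    by have [-> ->] := sepP xZ.
Qed.

End Separation.
End Coverings.

(** * Free amalgams *)

Section Embeddings.
Local Open Scope classical_set_scope.
Context {L : language}.
Implicit Types A B C D : structure L.

Definition idmap A B (f : A -> B) : smap A B := SMap (id, id) f.

Definition in_substr A (X : substr A) x (xX : x \in sset X) : X :=
  exist (fun y : A => y \in sset X) x xX.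

Lemma image_injective (T U : Type) (f : T -> U) (X Y : set T) :
  injective f -> f @` X = f @` Y -> X = Y.
Proof.
move=> fi eqf; apply/predeqP => x; rewrite -(image_inj (A := X) fi) eqf.
by rewrite image_inj.
Qed.

Lemma embedding_comp A B C (f : smap A B) (g : smap B C) :
  is_embedding f -> is_embedding g -> is_embedding (scomp g f).
Proof.
move=> [Gf fi fr ff] [Gg gi gr gf]; split=> /=.
- exact: lang_grpM.
- exact: inj_comp.
- by move=> R s; rewrite fr gr map_comp.
- by move=> F s; rewrite -image_comp ff gf map_comp.
Qed.

Lemma embedding_factor A B C (f : smap A B) (g : smap B C) :
  is_embedding g -> is_embedding (scomp g f) -> lang_grp (lmap f) -> is_embedding f.
Proof.
move=> [Gg gi gr gf] [_ gfi gfr gff] Gf; split=> //.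
- by move=> x y eqf; apply: gfi; rewrite /= eqf.
- by move=> R s; rewrite gfr /= gr map_comp.
- move=> F s; apply: (image_injective gi).
  by rewrite gf image_comp -map_comp; exact: gff.
Qed.

Lemma image_isomorphic A B (f : smap A B) (f_emb : is_embedding f) :
  isomorphic A (image_substr f_emb).
Proof.
case: f f_emb => -[l1 l2] f f_emb.
have fS x : f x \in sset (image_substr f_emb) by apply/mem_set; exists x.
pose h : smap A (image_substr f_emb) := SMap (l1, l2) (fun x => in_substr (fS x)).
have [Gf fi fr ff] := f_emb.
exists h; split.
  by apply: (embedding_factor (incl_embedding (image_substr f_emb))) => //.
have /choice[k kP] : forall y : image_substr f_emb, exists x, f x = val y.
  by move=> y; have /set_mem[x _ <-] := valP y; exists x.
exists k => x; last by apply: val_inj; rewrite /= kP.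
by apply: fi; rewrite /= kP.
Qed.

Section FreeAmalgam.
Variables D1 D2 Z : structure L.
Variables (e1 : Z -> D1) (e2 : Z -> D2).
Hypotheses (e1_emb : is_embedding (idmap e1)) (e2_emb : is_embedding (idmap e2)).

(** The amalgam consists of [D1] and the points of [D2] outside the base. As a subtype of the sum it
    is countable without forming a quotient. *)
Definition off_base (w : D1 + D2) : bool :=
  if w is inr y then `[< ~ exists z, e2 z = y >] else true.

Definition pushout_vertex : countType := {w : D1 + D2 | off_base w}.

Definition inj1 (x : D1) : pushout_vertex :=
  exist (fun w => off_base w)
    (inl x) isT.

Definition inj2 (y : D2) : pushout_vertex :=
  match pselect (exists z, e2 z = y) with
  | left yZ => inj1 (e1 (projT1 (cid yZ)))
  | right yZ => exist (fun w => off_base w) (inr y) (asboolT yZ)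
  end.

Lemma inj1_inj : injective inj1.
Proof. by move=> x y /(congr1 val)[]. Qed.

Lemma inj2_Z z : inj2 (e2 z) = inj1 (e1 z).
Proof.
rewrite /inj2; case: pselect => [zZ|nZ]; last by case: nZ; exists z.
case: cid => z' /= eqz; have [_ e2i _ _] := e2_emb.
by rewrite (e2i _ _ eqz).
Qed.

Lemma inj1_inj2 x y : inj1 x = inj2 y -> exists2 z, x = e1 z & y = e2 z.
Proof.
rewrite /inj2; case: pselect => [zZ|nZ /(congr1 val)//].
by case: cid => z /= eqz /inj1_inj ->; exists z.
Qed.

Lemma inj2_inj : injective inj2.
Proof.
move=> x y; have [[z <-]|xZ] := pselect (exists z, e2 z = x).
  rewrite inj2_Z => /inj1_inj2[z' eqz ->]; have [_ e1i _ _] := e1_emb.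
  by rewrite (e1i _ _ eqz).
have [[z <-]|yZ] := pselect (exists z, e2 z = y).
  by rewrite inj2_Z => /esym/inj1_inj2[z' _ eqx]; case: xZ; exists z'.
by rewrite /inj2; do 2 case: pselect => // ?; move=> /(congr1 val)[].
Qed.

Lemma inj12_cover w : (exists x, w = inj1 x) \/ (exists y, w = inj2 y).
Proof.
case: w => -[x wV|y wV]; [left; exists x|right; exists y]; apply: val_inj => //=.
by rewrite /inj2; case: pselect => // yZ; have /asboolP[] := wV.
Qed.

(** Tuples on both sides come from the base, on which the two structures agree; so the amalgam
    induces the given structure on each side. *)
Lemma map_inj12 s t : map inj1 s = map inj2 t ->
  exists r, s = map e1 r /\ t = map e2 r.
Proof.
elim: s t => [|x s IHs] [|y t] //=; first by exists [::].
by move=> [/inj1_inj2[z -> ->] /IHs[r [-> ->]]]; exists (z :: r).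
Qed.

Definition pushout_rel R (s : seq pushout_vertex) : Prop :=
  (exists2 t, s = map inj1 t & srel R t) \/ (exists2 t, s = map inj2 t & srel R t).

Definition pushout_fun F (s : seq pushout_vertex) : set pushout_vertex :=
  [set w | (exists t x, [/\ s = map inj1 t, w = inj1 x & sfun F t x]) \/
           (exists t y, [/\ s = map inj2 t, w = inj2 y & sfun F t y])].

Fact pushout_rel_size R s : pushout_rel R s -> size s = rel_ar R.
Proof. by move=> [] [t -> /srel_size]; rewrite size_map. Qed.

Fact pushout_fun_size F s w : pushout_fun F s w -> size s = fun_ar F.
Proof. by move=> [] [t [y [-> _ /sfun_size]]]; rewrite size_map. Qed.

Definition pushout : structure L := Structure pushout_rel_size pushout_fun_size.

Lemma inj1_embedding : is_embedding (idmap (inj1 : D1 -> pushout)).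
Proof.
have [_ _ e1r e1f] := e1_emb; have [_ _ e2r e2f] := e2_emb.
split=> [| |R s|F s] /=; [exact: lang_grp1|exact: inj1_inj| |].
- split=> [Rs|[] [t]]; first by left; exists s.
    by move=> /(inj_map inj1_inj) ->.
  by move=> /map_inj12[r [-> ->]] /e2r; exact: (e1r R r).1.
- apply/seteqP; split=> [_ [x Fx <-]|w [] [t [y]]]; first by left; exists s, x.
    by move=> [/(inj_map inj1_inj) -> ->]; exists y.
  move=> [/map_inj12[r [-> ->]] -> ]; have := e2f F r => /= <- [z Fz <-].
  rewrite inj2_Z; exists (e1 z) => //.
  by have := e1f F r => /= <-; exists z.
Qed.

Lemma inj2_embedding : is_embedding (idmap (inj2 : D2 -> pushout)).
Proof.
have [_ _ e1r e1f] := e1_emb; have [_ _ e2r e2f] := e2_emb.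
split=> [| |R s|F s] /=; [exact: lang_grp1|exact: inj2_inj| |].
- split=> [Rs|[] [t]]; first by right; exists s.
    by move=> /esym/map_inj12[r [-> ->]] /e1r; exact: (e2r R r).1.
  by move=> /(inj_map inj2_inj) ->.
- apply/seteqP; split=> [_ [x Fx <-]|w [] [t [y]]]; first by right; exists s, x.
    move=> [/esym/map_inj12[r [-> ->]] -> ]; have := e1f F r => /= <- [z Fz <-].
    rewrite -inj2_Z; exists (e2 z) => //.
    by have := e2f F r => /= <-; exists z.
  by move=> [/(inj_map inj2_inj) -> ->]; exists y.
Qed.

Lemma pushout_free : is_free_amalgamation (idmap e1) (idmap e2)
  (idmap (inj1 : D1 -> pushout)) (idmap (inj2 : D2 -> pushout)).
Proof.
split.
- split.
    split=> //; [exact: inj1_embedding|exact: inj2_embedding|].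
    by congr SMap; apply/funext => z /=; rewrite inj2_Z.
  apply/seteqP; split=> [w [[x _ <-] [y _]]|_ [z _ <-]] /=.
    by move=> /esym/inj1_inj2[z -> _]; exists z.
  by split; [exists (e1 z)|exists (e2 z) => //; rewrite inj2_Z].
- by apply/seteqP; split=> // w _; have [[x ->]|[y ->]] := inj12_cover w;
    [left; exists x|right; exists y].
- move=> s x y xs ys [x' nx eqx] [y' ny eqy]; subst x y.
  have out1 t : s <> map inj1 t.
    move=> eqs; rewrite eqs in ys; have /mapP[x'' _ /esym/inj1_inj2[z _ eqy]] := ys.
    by apply: ny; exists z.
  have out2 t : s <> map inj2 t.
    move=> eqs; rewrite eqs in xs; have /mapP[y'' _ /inj1_inj2[z eqx _]] := xs.
    by apply: nx; exists z.
  split=> [R [] [t]|F]; [by move/out1|by move/out2|].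
  by apply/seteqP; split=> // w [] [t [v []]]; [move/out1|move/out2].
Qed.

End FreeAmalgam.
End Embeddings.

(** * Tree amalgams *)

Section Trees.
Local Open Scope classical_set_scope.
Variables (L : language) (unary : unary_functions L) (A : structure L).

Lemma sfun_unary (M : structure L) F (s : seq M) x : sfun F s x -> exists y, s = [:: y].
Proof. by move/sfun_size; rewrite unary; case: s => [|y []] //; exists y. Qed.

(** * Guarded structures as structures, and their local embeddings *)

Section Structure.
Variables (B : gstr L A) (Bwf : gstr_wf B).

Definition gsfun F (s : seq B) : set B := [set y | exists2 x, s = [:: x] & gfun F x y].

Fact gsfun_size F s x : gsfun F s x -> size s = fun_ar F.
Proof. by move=> [y -> _]; rewrite unary. Qed.

Definition gstructure : structure L :=
  @Structure L B (@gsrel L A B) gsfun (gsrel_size Bwf) gsfun_size.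

Lemma gsfun1 F (x y : B) : gsfun F [:: x] y <-> gfun F x y.
Proof. by split=> [[_ [<-]]|xy]; last exists x. Qed.

Definition to_gstructure (X : structure L) (h : X -> B) : smap X gstructure :=
  @SMap L X gstructure (id, id) h.

Definition chart_smap (l : lperm L) : smap A gstructure :=
  @SMap L A gstructure l (chart B).

Definition perm_smap (l : lperm L) (g : {perm B}) : smap gstructure gstructure :=
  @SMap L gstructure gstructure l (fun x : B => g x).

Lemma gaut_automorphism l g : gaut (B := B) l g ->
  is_automorphism (perm_smap l g).
Proof.
move=> gA; split; last by exists (g^-1)%g; [exact: permK|exact: permKV].
split=> //=; [exact: gaut_lang gA|exact: perm_inj|exact: gaut_rel gA|].
move=> F s; apply/seteqP; split=> [_ [y [x -> xy] <-]|y [x]].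
  by exists (g x) => //; apply: (gaut_fun gA F x y).1.
case: s => [|z []] //= -[<-] zy; exists ((g^-1)%g y); last exact: permKV.
by exists z => //; apply: (gaut_fun gA F z _).2; rewrite permKV.
Qed.

(* An irreducible structure is the union of [{z | x is not in the closure of z}]
   and [{z | y is not in the closure of z}] unless [x] and [y] are linked by a
   closure or by a tuple. *)
Lemma irreducible_guard (X : structure L) (h : X -> B) :
  is_embedding (to_gstructure h) -> irreducible X ->
  forall x y, guard (h x) (h y).
Proof.
move=> [_ hi hr hf] Xirr x y; case xy: (guard (h x) (h y)) => //; exfalso.
have cl_guard (u v w : B) : guard u w -> cl u v -> guard v w.
  move=> uw uv; apply: (@cl_ind_rel L A B (fun v => guard v w)) uv uw => F v1 v2.
  exact: guard_fun.
have hfun F s z : sfun F s z -> exists2 w, s = [:: w] & gfun F (h w) (h z).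
  move=> Fz; have [w eqs] := sfun_unary Fz; exists w => //; apply/gsfun1.
  by have := hf F s; rewrite eqs /= => <-; exists z => //; rewrite -eqs.
pose away v := [set z : X | ~~ cl (h z) (h v)].
have away_closed v F (s : seq X) : {in s, forall z, away v z} -> sfun F s `<=` away v.
  move=> sv z /hfun[w eqs wz] /=; apply: contra (sv w _) => [zv|]; last by rewrite eqs mem_head.
  by apply: connect_trans zv; apply: connect1; apply/asboolP; exists F.
have both_closed F (s : seq X) : {in s, forall z, (away x `&` away y) z} ->
    sfun F s `<=` away x `&` away y.
  by move=> sxy z Fz; split; (apply: away_closed Fz => w /sxy[]).
have proper v : away v <> [set: X].
  move=> /predeqP/(_ v)[_ /(_ I)] /negP; apply; apply: connect0.
pose Xx := Substr (@away_closed x); pose Xy := Substr (@away_closed y).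
pose Z := Substr both_closed.
have Zx : sset Z `<=` sset Xx by move=> z [].
have Zy : sset Z `<=` sset Xy by move=> z [].
have sub_emb (U V : substr X) (UV : sset U `<=` sset V) : is_embedding (sub_incl UV).
  apply: (embedding_factor (incl_embedding V)); last exact: lang_grp1.
  exact: Defs.incl_embedding.
apply: Xirr; exists Xx, Xy, Z, Zx, Zy; split; [exact: proper|exact: proper|].
have inE' (U : substr X) z : range (Defs.incl U) z <-> sset U z.
  split=> [[u _ <-]|Uz]; first exact: set_mem (valP u).
  by exists (in_substr (mem_set Uz)).
split.
- split.
    split; [exact: sub_emb|exact: sub_emb|exact: Defs.incl_embedding|exact: Defs.incl_embedding|].
    by [].
  apply/seteqP; split=> [z [/inE' zx /inE' zy]|_ [z _ <-]].
    by exists (in_substr (mem_set (conj zx zy) : z \in sset Z)).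
  have [zx zy] := set_mem (valP z).
  by split; apply/inE'.
- apply/seteqP; split=> // z _.
  (* A vertex whose closure contains both [x] and [y] would make these guarded, so every [z] lies in
     one of the two parts. *)
  have [zx|zx] := boolP (cl (h z) (h x)); last by left; apply/inE'.
  right; apply/inE'; apply/negP => zy; move: xy.
  rewrite (cl_guard _ _ _ _ zx) // guard_sym // (cl_guard _ _ _ _ zy) //.
  exact: guard_refl.
- move=> s z w zs ws [z' nz eqz] [w' nw eqw].
  have zx : away x z by rewrite -eqz; exact: set_mem (valP z').
  have wy : away y w by rewrite -eqw; exact: set_mem (valP w').
  have zy : cl (h z) (h y).
    apply: contrapT => /negP zy; apply: nz.
    exists (in_substr (mem_set (conj zx zy) : z \in sset Z)) => //.
    exact: val_inj.
  have wx : cl (h w) (h x).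
    apply: contrapT => /negP wx; apply: nw.
    exists (in_substr (mem_set (conj wx wy) : w \in sset Z)) => //.
    exact: val_inj.
  (* The closure of [z] contains [y] and that of [w] contains [x], so a guard between [w] and [z]
     would pass on to [x] and [y]. *)
  have wz : ~~ guard (h w) (h z).
    apply: contraFN xy => wz; apply: (cl_guard (h w)) wx.
    by rewrite guard_sym //; apply: (cl_guard (h z)) zy; rewrite guard_sym.
  split=> [R /hr /(gsrel_guard Bwf) Rs|F].
    by move: wz; rewrite Rs ?map_f.
  apply/seteqP; split=> // d /hfun[v eqs _]; move: zs ws wz.
  by rewrite eqs !mem_seq1 => /eqP -> /eqP ->; rewrite guard_refl.
Qed.

(** Injectivity and exactness of relations are asked on guarded tuples only, which is enough for
    homomorphism-embeddings because irreducible structures are guarded. On a closed [S] only the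
    values of [f] on [S] matter, by [local_ext]. *)
Definition local_embedding (S : {set B}) (D : structure L) (f : B -> D) : Prop :=
  [/\ forall F x d, x \in S -> (sfun F [:: f x] d <-> exists2 y, gfun F x y & f y = d),
      {in S &, forall x y, guard x y -> f x = f y -> x = y} &
      forall R s, {subset s <= S} -> {in s &, forall x y, guard x y} ->
        (gsrel R s <-> srel R (map f s))].

Lemma local_ext (S : {set B}) (D : structure L) (f g : B -> D) :
  closed_in S -> {in S, f =1 g} -> local_embedding S f -> local_embedding S g.
Proof.
move=> cS fg [lf li lr]; split=> [F x d xS|x y xS yS|R s sS sg].
- rewrite -fg // lf //; split=> -[y xy <-]; exists y => //; first by rewrite fg //; apply: cS xy.
  by rewrite fg //; apply: cS xy.
- by rewrite -!fg //; apply: li.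
- rewrite lr //; have -> // : map f s = map g s.
  by apply/eq_in_map => x /sS; apply: fg.
Qed.

Lemma local_comp (S : {set B}) (D C : structure L) (f : B -> D) (b : D -> C) :
  is_embedding (idmap b) -> local_embedding S f -> local_embedding S (b \o f).
Proof.
move=> [_ bi br bf] [lf li lr]; split=> [F x d xS|x y xS yS xy /bi|R s sS sg].
- have /= <- := bf F [:: f x]; split=> [[e /lf-/(_ xS)[y xy <-] <-]|[y xy <-]].
    by exists y.
  by exists (f y) => //; apply/(lf _ _ _ xS); exists y.
- exact: li.
- by rewrite lr // br map_comp.
Qed.

(** No guard joins the two differences, so a guarded tuple of the union lies entirely in one of the
    parts. *)
Lemma local_union (S1 S2 : {set B}) (D : structure L) (f : B -> D) :
  (forall x y, x \in S1 -> x \notin S2 -> y \in S2 -> y \notin S1 -> ~~ guard x y) ->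
  local_embedding S1 f -> local_embedding S2 f -> local_embedding (S1 :|: S2) f.
Proof.
move=> sep [lf1 li1 lr1] [lf2 li2 lr2].
have one_side (s : seq B) : {subset s <= S1 :|: S2} ->
    {in s &, forall x y, guard x y} -> {subset s <= S1} \/ {subset s <= S2}.
  move=> sS sg; have [/allP s1|/allPn[y ys y1]] := boolP (all (mem S1) s); [by left|].
  right=> x xs; apply: contraT => x2.
  have : y \in S2 by have := sS _ ys; rewrite finset.in_setU (negbTE (y1 : y \notin S1)).
  have : x \in S1 by have := sS _ xs; rewrite finset.in_setU (negbTE x2) orbF.
  by move=> x1 y2; have := sep _ _ x1 x2 y2 y1; rewrite sg.
split=> [F x d|x y xS yS xy|R s sS sg].
- by rewrite finset.in_setU => /orP[/lf1|/lf2].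
- have [] := one_side [:: x; y].
  + by move=> z; rewrite !(mem_seq1, in_cons) => /orP[] /eqP ->.
  + move=> z w; rewrite !(mem_seq1, in_cons) => /orP[] /eqP -> /orP[] /eqP ->;
      rewrite ?guard_refl //; by rewrite guard_sym.
  + by move=> s1; apply: li1; rewrite ?s1 ?mem_head // in_cons mem_head orbT.
  + by move=> s2; apply: li2; rewrite ?s2 ?mem_head // in_cons mem_head orbT.
- by have [s1|s2] := one_side s sS sg; [apply: lr1|apply: lr2].
Qed.

Fact closed_substr (S : {set B}) : closed_in S ->
  forall F (s : seq gstructure), {in s, forall x, [set x | x \in S] x} ->
    sfun F s `<=` [set x | x \in S].
Proof. by move=> cS F s sS y [x eqs xy]; apply: cS xy; apply: sS; rewrite eqs mem_head. Qed.

Definition finsubstr (S : {set B}) (cS : closed_in S) : substr gstructure :=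
  Substr (closed_substr cS).

Lemma local_embedding_on (C : structure L) (e : C -> B) (S : {set B})
    (D : structure L) (f : B -> D) :
  is_embedding (to_gstructure e) -> (forall x, e x \in S) ->
  (forall x y, guard (e x) (e y)) -> local_embedding S f ->
  is_embedding (idmap (f \o e)).
Proof.
move=> [_ ei er ef] eS eg [lf li lr]; split=> /=.
- exact: lang_grp1.
- by move=> x y /li eqe; apply: ei; apply: eqe.
- move=> R s; rewrite er map_comp; apply: lr.
    by move=> _ /mapP[x _ ->].
  by move=> _ _ /mapP[x _ ->] /mapP[y _ ->].
- move=> F s; apply/seteqP; split=> [_ [x Fx <-]|d].
    have [z eqs] := sfun_unary Fx; rewrite eqs; apply/lf => //=; exists (e x) => //.
    apply/gsfun1; have := ef F [:: z] => /= <-; exists x => //.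
    by rewrite -eqs.
  move=> Fd; have [z' ] := sfun_unary Fd; case: s Fd => [|z []] //= Fd _.
  have /lf-/(_ (eS z))[y zy <-] := Fd; have : gsfun F [:: e z] y by apply/gsfun1.
  by have := ef F [:: z] => /= <- -[x Fx <-]; exists x.
Qed.

(** Relations hold on guarded tuples only, and irreducible substructures are cliques by
    [irreducible_guard]; there a local embedding is an embedding. *)
Lemma local_hom_embedding (C : structure L) (e : C -> B) (S : {set B})
    (D : structure L) (f : B -> D) :
  is_embedding (to_gstructure e) -> (forall x, e x \in S) ->
  local_embedding S f -> is_hom_embedding (idmap (f \o e)).
Proof.
move=> eE eS lE; have [_ ei er ef] := eE; have [lf li lr] := lE.
split; first split=> [|R s|F s] /=.
- exact: lang_grp1.
- move=> /er Rs; rewrite map_comp; apply/lr => //; last exact: gsrel_guard Rs.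
  by move=> _ /mapP[x _ ->].
- move=> _ [x Fx <-]; have [z eqs] := sfun_unary Fx; rewrite eqs; apply/lf => //=.
  exists (e x) => //; apply/gsfun1; have := ef F [:: z] => /= <-; exists x => //.
  by rewrite -eqs.
- move=> X Xirr; have eX : is_embedding (to_gstructure (fun z : X => e (val z))).
    exact: embedding_comp (incl_embedding X) eE.
  apply: (local_embedding_on (e := fun z : X => e (val z)) eX _ _ lE) => [x|].
    exact: eS.
  exact: irreducible_guard eX Xirr.
Qed.

(** The clause on cliques makes the induction work: tree amalgamations are glued along structures
    that embed into copies of [A]. *)
Definition tree_local (S : {set B}) : Prop := exists (D : structure L) (f : B -> D),
  [/\ tree_amalgamation A D, local_embedding S f &
      forall Q : {set B}, clique Q -> Q \subset S ->
        exists a : smap A D, is_embedding a /\ {in Q, forall x, exists b, f x = a b}].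

(** * Building tree amalgams by gluing along cliques *)

Section Copies.
Variable l0 : lperm L.
Hypothesis chart_emb : is_embedding (chart_smap l0).
Hypothesis cliques : cliques_in_copies B.

Lemma tree_local0 : tree_local finset.set0.
Proof.
(* The map is arbitrary; a singleton clique lies in a copy, so [A] has a vertex as soon as [B] has
   one. *)
have /choice[f _] : forall x : B, exists a : A, True.
  move=> x; have [|l [g [_ /(_ x)[]]]] := cliques (Q := [set x]%SET).
  - by move=> y z; rewrite !finset.in_set1 => /eqP -> /eqP ->; apply: guard_refl.
  - by rewrite finset.in_set1.
  - by move=> a _; exists a.
exists A, f; split.
- apply: tree_copy; exists (idmap id); split; last by exists id.
  split=> //=; [exact: lang_grp1|by move=> R s; rewrite map_id|].
  by move=> F s; rewrite map_id image_id.
- split=> [F x d|x y|R s s0 _]; rewrite ?finset.in_set0 //.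
  (* Only the empty tuple remains, and it is in no relation because arities are positive. *)
  have -> : s = [::] by case: s s0 => // x s /(_ x (mem_head _ _)); rewrite finset.in_set0.
  by split=> [/(gsrel_size Bwf)|/srel_size] => /= eq0; have := rel_ar_gt0 R; rewrite -eq0.
- move=> Q _ /fintype.subsetP Q0; exists (idmap id); split.
    split=> //=; [exact: lang_grp1|by move=> R s; rewrite map_id|].
    by move=> F s; rewrite map_id image_id.
  by move=> x /Q0; rewrite finset.in_set0.
Qed.

(** The copy of [A] that contains a nonempty clique serves as [D], with the identity on [S];
    [insubd] supplies a default outside this copy. *)
Lemma tree_local_clique (S : {set B}) : closed_in S -> clique S -> tree_local S.
Proof.
move=> cS qS; have [->|[x0 x0S]] := finset.set_0Vmem S; first exact: tree_local0.
have [l [g [gA gS]]] := cliques qS.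
have cE := embedding_comp chart_emb (gaut_automorphism gA).1.
pose D := image_substr cE.
have SD x : x \in S -> x \in sset D.
  by move=> /gS[a ->]; apply/mem_set; exists a.
pose f (x : B) : D := insubd (in_substr (SD _ x0S)) x.
have fE x : x \in S -> val (f x) = x by move=> /SD xD; rewrite /f insubdK.
exists D, f; split.
- exact/tree_copy/image_isomorphic.
- split=> [F x d xS|x y xS yS _ eqf|R s sS sg].
  + rewrite /= /induced_fun /= fE //; split=> [/gsfun1 xd|[y xy <-]].
      exists (val d) => //; apply: val_inj; rewrite fE //; exact: cS xd.
    by apply/gsfun1; rewrite fE //; apply: cS xy.
  + by rewrite -(fE x) // -(fE y) // eqf.
  + rewrite /= /induced_rel -map_comp; have -> // : map (val \o f) s = s.
    by rewrite map_id_in // => x /sS; apply: fE.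
- move=> Q _ _; have [a [aE [k _ ak]]] := image_isomorphic cE.
  by exists a; split=> // x _; exists (k (f x)); rewrite ak.
Qed.

(** The lift is given the inverse of the language part of [a], so that the composite has the
    identity as its language part. *)
Lemma embedding_lift (Z D : structure L) (e : Z -> D) (a : smap A D) :
  is_embedding (idmap e) -> is_embedding a -> (forall z, exists b, e z = a b) ->
  exists d : smap Z A, is_embedding d /\ scomp a d = idmap e.
Proof.
move=> eE aE /choice[d dE]; have [Ga _ _ _] := aE.
have [q Gq [_ qK1 _ qK2]] := lang_grpV Ga.
have eqe : scomp a (SMap q d) = idmap e.
  congr SMap; last by apply/funext => z; rewrite /= dE.
  by congr pair; apply/funext => x /=.
exists (SMap q d); split=> //.
by apply: embedding_factor aE _ _; rewrite ?eqe.
Qed.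

(** The intersection is a clique, so it embeds into a copy of [A] on either side and the free
    amalgam over it is again a tree amalgamation. A clique of the union lies in [S1] or in [S2],
    hence in a copy. *)
Lemma tree_local_union (S1 S2 : {set B}) :
  closed_in S1 -> closed_in S2 -> clique (S1 :&: S2) ->
  (forall x y, x \in S1 -> x \notin S2 -> y \in S2 -> y \notin S1 -> ~~ guard x y) ->
  tree_local S1 -> tree_local S2 -> tree_local (S1 :|: S2).
Proof.
move=> c1 c2 qZ sep [D1 [f1 [T1 l1 q1]]] [D2 [f2 [T2 l2 q2]]].
pose Zf := (S1 :&: S2)%SET.
have Z1 : Zf \subset S1 by apply: finset.subsetIl.
have Z2 : Zf \subset S2 by apply: finset.subsetIr.
have cZ : closed_in Zf.
  move=> F x y; rewrite !finset.in_setI => /andP[x1 x2] xy.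
  by rewrite (c1 _ _ _ x1 xy) (c2 _ _ _ x2 xy).
pose Z := finsubstr cZ.
have Zin (z : Z) : (val z : B) \in Zf by have := set_mem (valP z).
have ZE : is_embedding (to_gstructure (val : Z -> B)) := Defs.incl_embedding Z.
have Zg (x y : Z) : guard (val x : B) (val y) by apply: qZ; apply: Zin.
have [a1 [a1E a1P]] := q1 Zf qZ Z1; have [a2 [a2E a2P]] := q2 Zf qZ Z2.
pose e1 (z : Z) := f1 (val z); pose e2 (z : Z) := f2 (val z).
have e1E : is_embedding (idmap e1).
  apply: (local_embedding_on ZE _ Zg l1) => z.
  exact: (fintype.subsetP Z1 _ (Zin z)).
have e2E : is_embedding (idmap e2).
  apply: (local_embedding_on ZE _ Zg l2) => z.
  exact: (fintype.subsetP Z2 _ (Zin z)).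
have [d1 [d1E eqd1]] := embedding_lift e1E a1E (fun z => a1P _ (Zin z)).
have [d2 [d2E eqd2]] := embedding_lift e2E a2E (fun z => a2P _ (Zin z)).
pose f (x : B) : pushout e1 e2 :=
  if x \in S1 then inj1 e2 (f1 x) else inj2 e1 e2 (f2 x).
have fE1 : {in S1, inj1 e2 \o f1 =1 f} by move=> x x1; rewrite /f x1.
have fE2 : {in S2, inj2 e1 e2 \o f2 =1 f}.
  move=> x x2 /=; rewrite /f; case: ifPn => // x1.
  have xZ : x \in sset Z by apply/mem_set; rewrite /= finset.in_setI x1.
  exact: (inj2_Z e1 e2E (in_substr xZ)).
have i1E := inj1_embedding e1E e2E; have i2E := inj2_embedding e1E e2E.
exists (pushout e1 e2), f; split.
- apply: (tree_glue T1 T2 a1E a2E d1E d2E); rewrite eqd1 eqd2.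
  exact: pushout_free.
- apply: local_union => //.
    by apply: (local_ext (D := pushout e1 e2) c1 fE1); apply: local_comp.
  by apply: (local_ext (D := pushout e1 e2) c2 fE2); apply: local_comp.
- move=> Q qQ QS.
  have [Q1|/fintype.subsetPn[y yQ y1]] := boolP (Q \subset S1).
    have [a [aE aP]] := q1 Q qQ Q1; exists (scomp (idmap (inj1 e2 : D1 -> pushout e1 e2)) a).
    split; first exact: embedding_comp.
    move=> x xQ; have [b eqb] := aP x xQ; exists b.
    by rewrite -fE1 ?(fintype.subsetP Q1) //= eqb.
  have Q2 : Q \subset S2.
    apply/fintype.subsetP => x xQ; apply: contraT => x2.
    have := fintype.subsetP QS _ xQ; have := fintype.subsetP QS _ yQ.
    rewrite !finset.in_setU (negbTE y1) (negbTE x2) orbF /= => y2 x1.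
    by have := sep _ _ x1 x2 y2 y1; rewrite qQ.
  have [a [aE aP]] := q2 Q qQ Q2.
  exists (scomp (idmap (inj2 e1 e2 : D2 -> pushout e1 e2)) a).
  split; first exact: embedding_comp.
  move=> x xQ; have [b eqb] := aP x xQ; exists b.
  by rewrite -fE2 ?(fintype.subsetP Q2) //= eqb.
Qed.

(* Cliques are handled directly, and any other set splits along a clique. *)
Lemma tree_local_lifted (B' : gstr L A) (p : B' -> B) (S' : {set B'}) :
  colors_feasible 2 p ->
  {in S' &, forall x y, guard (p x) (p y) -> guard x y} ->
  forall S : {set B}, S \subset p @: S' -> closed_in S -> tree_local S.
Proof.
move=> pF S'g S; have [k] := ubnP #|S|; elim: k S => // k IHk S Sk SS' cS.
have [qS|] := pselect (clique S); first exact: tree_local_clique.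
move=> nqS; have [u [v [uS vS uv]]] : exists u v, [/\ u \in S, v \in S & ~~ guard u v].
  apply: contrapT => nuv; apply: nqS => u v uS vS; apply: contrapT => /negP uv.
  by apply: nuv; exists u, v.
have [S1 [S2 [eqS c1 c2 q12 [p1 p2 sep]]]] :=
  separation Bwf pF S'g SS' cS uS vS uv.
have IH (S0 : {set B}) : S0 \proper S -> closed_in S0 -> tree_local S0.
  move=> S0S; apply: IHk; first exact: leq_trans (proper_card S0S) _.
  exact: fintype.subset_trans (proper_sub S0S) SS'.
by rewrite eqS; apply: tree_local_union => //; apply: IH.
Qed.

End Copies.
End Structure.

Definition trees_below k (B : gstr L A) : Prop :=
  forall S : {set B}, closed_in S -> #|unguarded S| < k -> tree_local S.

Lemma tree_local_covering (B' B : gstr L A) (p : B' -> B) (S : {set B'}) :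
  covering p -> tree_local (p @: S) -> tree_local S.
Proof.
move=> pC [D [f [TD [lf li lr] qf]]]; exists D, (f \o p); split=> //.
  split=> [F x d xS|x y xS yS xy|R s sS sg] /=.
  - rewrite lf ?imset_f //; split=> [[y xy <-]|[y xy <-]].
      by have [y' xy' <-] := cov_fun_lift pC xy; exists y'.
    by exists (p y) => //; apply: cov_fun xy.
  - move=> eqf; apply: (cov_inj pC xy); apply: li; rewrite ?imset_f //.
    exact: cov_guard xy.
  - rewrite (cov_rel pC R sg) map_comp; apply: lr.
      by move=> _ /mapP[x xs ->]; apply/imset_f/sS.
    by move=> _ _ /mapP[x xs ->] /mapP[y ys ->]; apply/(cov_guard pC)/sg.
move=> Q qQ QS; have [|a [aE aP]] := qf (p @: Q) (covering_clique pC qQ).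
  exact: imsetS.
by exists a; split=> // x xQ; apply: aP; apply: imset_f.
Qed.

(** If some unguarded pair of [S] becomes guarded under [p], the image has fewer unguarded pairs and
    is covered by the assumption on [B]. Otherwise [S] reflects guards and its image splits along
    cliques. *)
Lemma trees_below_step k (B' B : gstr L A) (Bwf : gstr_wf B)
    (p : B' -> B) (l0 : lperm L) :
  is_embedding (chart_smap Bwf l0) -> cliques_in_copies B ->
  covering p -> colors_feasible 2 p ->
  trees_below k B -> trees_below k.+1 B'.
Proof.
move=> cE qB pC pF tB S cS Sk; apply: (tree_local_covering pC).
have cpS := closed_imset pC cS.
have [[x [y [xS yS pxy xy]]]|nxy] := pselect (exists x y,
    [/\ x \in S, y \in S, guard (p x) (p y) & ~~ guard x y]).
  apply: tB => //; rewrite -ltnS; apply: leq_trans Sk.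
  by rewrite ltnS; apply: unguarded_drop xS yS pxy xy.
apply: (tree_local_lifted cE qB pF (S' := S)) => // x y xS yS pxy.
by apply: contrapT => /negP xy; apply: nxy; exists x, y.
Qed.

End Trees.

(** * Partial automorphisms *)

Section PartialAutomorphisms.
Local Open Scope classical_set_scope.
Variables (L : language) (unary : unary_functions L) (A : structure L).

(** Partial automorphisms are encoded by graphs on [A]: maps between substructures have types that
    depend on [M], whereas graphs can be shared by all levels of the tower. *)
Record partial_aut (M : structure L) (c : A -> M) (l : lperm L)
    (H : A -> A -> Prop) : Prop := {
  paut_lang : lang_grp l;
  paut_inj : forall a b a' b', H a b -> H a' b' -> (a = a' <-> b = b');
  paut_dom : forall F a b a', H a b -> sfun F [:: c a] (c a') -> exists b', H a' b';
  paut_ran : forall F a b b', H a b -> sfun F [:: c b] (c b') -> exists a', H a' b';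
  paut_fun : forall F a b a' b', H a b -> H a' b' ->
    (sfun F [:: c a] (c a') <-> sfun (l.2 F) [:: c b] (c b'));
  paut_rel : forall R (s : seq (A * A)), (forall q, q \in s -> H q.1 q.2) ->
    (srel R (map (c \o fst) s) <-> srel (l.1 R) (map (c \o snd) s))
}.

Lemma partial_aut_transfer (M N : structure L) (c : A -> M) (d : A -> N) l H :
  (forall F a b, sfun F [:: c a] (c b) <-> sfun F [:: d a] (d b)) ->
  (forall R s, srel R (map c s) <-> srel R (map d s)) ->
  partial_aut c l H -> partial_aut d l H.
Proof.
move=> cdf cdr [Gl Hi Hd Hr Hf HR]; split=> //.
- by move=> F a b a' Hab /cdf; apply: Hd Hab.
- by move=> F a b b' Hab /cdf; apply: Hr Hab.
- by move=> F a b a' b' Hab Hab'; rewrite -!cdf; apply: Hf.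
- move=> R s Hs; have := HR R s Hs.
  by rewrite (map_comp c fst) (map_comp c snd) (map_comp d fst) (map_comp d snd) !cdr.
Qed.

(** * Isomorphisms between substructures of the copy and their graphs *)

Section Isomorphisms.
Variables (M : structure L) (psi : smap A M) (psi_emb : is_embedding psi).
Let W := image_substr psi_emb.

Definition graph (X Y : substr W) (f : smap X Y) (a b : A) : Prop :=
  exists x : X, val (val x) = psi a /\ val (val (f x)) = psi b.

Lemma image_preim (w : W) : exists a, val w = psi a.
Proof. by have /set_mem[a _ <-] := valP w; exists a. Qed.

Lemma partial_aut_iso (X Y : substr W) (f : smap X Y) :
  is_isomorphism f -> partial_aut psi (lmap f) (graph f).
Proof.
move=> [[Gf fi fr ff] [k fk kf]]; have [_ pi _ _] := psi_emb.
have ffE F (x y : X) : sfun F [:: val (val x)] (val (val y)) <->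
    sfun ((lmap f).2 F) [:: val (val (f x))] (val (val (f y))).
  have := ff F [:: x]; rewrite /= => /predeqP/(_ (f y))[h1 h2]; split=> h.
    by apply: h1; exists y.
  by have [z hz /fi <-] := h2 h.
split=> //.
- move=> a b a' b' [x [xa xb]] [x' [xa' xb']]; split=> eqab.
    have eqx : x = x' by do 2 apply: val_inj; rewrite xa xa' eqab.
    by apply: pi; rewrite -xb -xb' eqx.
  have eqx : f x = f x' by do 2 apply: val_inj; rewrite xb xb' eqab.
  by apply: pi; rewrite -xa -xa' (fi _ _ eqx).
- move=> F a b a' [x [xa xb]] aa'.
  have a'W : psi a' \in sset W by apply/mem_set; exists a'.
  have a'X : in_substr a'W \in sset X.
    apply/mem_set; apply: (sset_closed (s := [:: val x]) (F := F)).
      by move=> z; rewrite mem_seq1 => /eqP ->; apply: set_mem (valP x).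
    by rewrite /= /induced_fun /= xa.
  have [b' b'E] := image_preim (val (f (in_substr a'X))).
  by exists b', (in_substr a'X).
- move=> F a b b' [x [xa xb]] bb'.
  have b'W : psi b' \in sset W by apply/mem_set; exists b'.
  have b'Y : in_substr b'W \in sset Y.
    apply/mem_set; apply: (sset_closed (s := [:: val (f x)]) (F := F)).
      by move=> z; rewrite mem_seq1 => /eqP ->; apply: set_mem (valP (f x)).
    by rewrite /= /induced_fun /= xb.
  have [a' a'E] := image_preim (val (k (in_substr b'Y))).
  by exists a', (k (in_substr b'Y)); rewrite kf.
- by move=> F a b a' b' [x [<- <-]] [x' [<- <-]]; apply: ffE.
- move=> R s Hs.
  have [t [-> ->]] : exists t : seq X, map (psi \o fst) s = map (val \o val) t /\
      map (psi \o snd) s = map (val \o (val \o f)) t.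
    elim: s Hs => [|[a b] s IHs] Hs; first by exists [::].
    have [x [xa xb]] := Hs _ (mem_head _ _); have [q qs|t [eq1 eq2]] := IHs.
      by apply: Hs; rewrite inE qs orbT.
    by exists (x :: t); rewrite /= eq1 eq2 xa xb.
  have := fr R t; rewrite /= /induced_rel /= /induced_rel.
  by rewrite (map_comp val val) (map_comp val (val \o f)) (map_comp val f).
Qed.

(** Domain and range of [H] are closed by [paut_dom] and [paut_ran], hence substructures, and
    [paut_inj] makes [H] a bijection between them. *)
Lemma iso_of_partial_aut l H : partial_aut psi l H ->
  exists (X Y : substr W) (f : smap X Y),
    [/\ is_isomorphism f, lmap f = l & forall a b, graph f a b <-> H a b].
Proof.
move=> [Gl Hi Hd Hr Hf HR]; have [_ pi _ _] := psi_emb.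
pose dX : set W := [set w | exists a b, H a b /\ val w = psi a].
pose dY : set W := [set w | exists a b, H a b /\ val w = psi b].
have cX F (s : seq W) : {in s, forall w, dX w} -> sfun F s `<=` dX.
  move=> sX w Fw; have [w0 eqs] := sfun_unary unary Fw.
  have w0s : w0 \in s by rewrite eqs mem_head.
  have [a [b [Hab eqw0]]] := sX w0 w0s.
  have [a' eqw] := image_preim w; have [|b' Hab'] := Hd F a b a' Hab.
    by rewrite -eqw -eqw0; move: Fw; rewrite eqs.
  by exists a', b'.
have cY F (s : seq W) : {in s, forall w, dY w} -> sfun F s `<=` dY.
  move=> sX w Fw; have [w0 eqs] := sfun_unary unary Fw.
  have w0s : w0 \in s by rewrite eqs mem_head.
  have [a [b [Hab eqw0]]] := sX w0 w0s.
  have [b' eqw] := image_preim w; have [|a' Hab'] := Hr F a b b' Hab.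
    by rewrite -eqw -eqw0; move: Fw; rewrite eqs.
  by exists a', b'.
pose X := Substr cX; pose Y := Substr cY.
have imW a : psi a \in sset W by apply/mem_set; exists a.
have inX a b : H a b -> exists x : X, val (val x) = psi a.
  move=> Hab; have aX : in_substr (imW a) \in sset X.
    by apply/mem_set; exists a, b.
  by exists (in_substr aX).
have inY a b : H a b -> exists y : Y, val (val y) = psi b.
  move=> Hab; have bY : in_substr (imW b) \in sset Y.
    by apply/mem_set; exists a, b.
  by exists (in_substr bY).
have fX (x : X) : exists y : Y, exists a b,
    [/\ H a b, val (val x) = psi a & val (val y) = psi b].
  have /set_mem[a [b [Hab xa]]] := valP x; have [y yb] := inY a b Hab.
  by exists y, a, b.
have fY (y : Y) : exists x : X, exists a b,
    [/\ H a b, val (val x) = psi a & val (val y) = psi b].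
  have /set_mem[a [b [Hab xb]]] := valP y; have [x xa] := inX a b Hab.
  by exists x, a, b.
have /choice[f fP] := fX; have /choice[k kP] := fY.
have fk : cancel f k.
  move=> x; have [a [b [Hab xa xb]]] := fP x; have [a' [b' [Hab' xa' xb']]] := kP (f x).
  do 2 apply: val_inj; rewrite xa xa'; congr (psi _).
  by apply/(Hi _ _ _ _ Hab' Hab)/pi; rewrite -xb -xb'.
have kf : cancel k f.
  move=> y; have [a [b [Hab xa xb]]] := kP y; have [a' [b' [Hab' xa' xb']]] := fP (k y).
  do 2 apply: val_inj; rewrite xb xb'; congr (psi _).
  by apply/(Hi _ _ _ _ Hab' Hab)/pi; rewrite -xa -xa'.
have gE a b : graph (SMap l f) a b <-> H a b.
  split=> [[x [xa xb]]|Hab].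
    have [a' [b' [Hab' xa' xb']]] := fP x.
    have -> : a = a' by apply: pi; rewrite -xa -xa'.
    by have -> : b = b' by apply: pi; rewrite -xb -xb'.
  have [x xa] := inX a b Hab; exists x; split=> //.
  have [a' [b' [Hab' xa' xb']]] := fP x; rewrite /= xb'; congr (psi _).
  by apply/(Hi _ _ _ _ Hab' Hab)/pi; rewrite -xa -xa'.
exists X, Y, (SMap l f); split=> //; split; last by exists k.
split=> //=; first exact: can_inj fk.
- move=> R s; rewrite /induced_rel /= /induced_rel.
  have [t [Ht -> ->]] : exists t : seq (A * A), [/\ forall q, q \in t -> H q.1 q.2,
      map val (map val s) = map (psi \o fst) t &
      map val (map val (map f s)) = map (psi \o snd) t].
    elim: s => [|x s [t [Ht eq1 eq2]]]; first by exists [::].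
    have [a [b [Hab xa xb]]] := fP x; exists ((a, b) :: t); split=> /=.
    - by move=> q; rewrite inE => /orP[/eqP -> //|]; apply: Ht.
    - by rewrite eq1 xa.
    - by rewrite eq2 xb.
  exact: HR.
- move=> F s; apply/seteqP; split=> [_ [x Fx <-]|y Fy].
    have [z' ] := sfun_unary unary Fx; case: s Fx => [|z []] //= Fx _.
    have [a [b [Hab xa xb]]] := fP x; have [a' [b' [Hab' xa' xb']]] := fP z.
    move: Fx; rewrite /= /induced_fun /= /induced_fun /= xa xa' xb xb'.
    by apply: (Hf _ _ _ _ _ Hab' Hab).1.
  have [z' ] := sfun_unary unary Fy; case: s Fy => [|z []] //= Fy _.
  exists (k y); last exact: kf.
  have [a [b [Hab xa xb]]] := kP y; have [a' [b' [Hab' xa' xb']]] := fP z.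
  move: Fy; rewrite /= /induced_fun /= /induced_fun /= xa xa' xb xb'.
  by apply: (Hf _ _ _ _ _ Hab' Hab).2.
Qed.

Lemma substr_eq (N : structure L) (X Y : substr N) : sset X = sset Y -> X = Y.
Proof.
by case: X Y => [X cX] [Y cY] /= eqX; subst Y; congr Substr; apply: Prop_irrelevance.
Qed.

Lemma sset_dom (X Y : substr W) (f : smap X Y) w :
  sset X w <-> exists a b, graph f a b /\ val w = psi a.
Proof.
split=> [Xw|[a [b [[x [xa _]] wa]]]].
  pose x : X := in_substr (mem_set Xw).
  have [a wa] := image_preim w; have [b fb] := image_preim (val (f x)).
  by exists a, b; split=> //; exists x.
have -> : w = val x by apply: val_inj; rewrite wa xa.
exact: set_mem (valP x).
Qed.

Lemma sset_ran (X Y : substr W) (f : smap X Y) w : is_isomorphism f ->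
  sset Y w <-> exists a b, graph f a b /\ val w = psi b.
Proof.
move=> [_ [k fk kf]]; split=> [Yw|[a [b [[x [_ xb]] wb]]]].
  pose y : Y := in_substr (mem_set Yw).
  have [b wb] := image_preim w; have [a ka] := image_preim (val (k y)).
  by exists a, b; split=> //; exists (k y); rewrite kf.
have -> : w = val (f x) by apply: val_inj; rewrite wb xb.
exact: set_mem (valP (f x)).
Qed.

Lemma smap_eq (X Y : substr W) (f g : smap X Y) : lmap f = lmap g ->
  (forall a b, graph f a b -> graph g a b) -> f = g.
Proof.
move=> eql fg; case: f g eql fg => l f [l' g] /= -> fg; congr SMap.
have [_ pi _ _] := psi_emb.
apply/funext => x; have [a xa] := image_preim (val x).
have [b xb] := image_preim (val (f x)).
have [|x' [x'a x'b]] := fg a b; first by exists x.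
have eqx : x' = x by do 2 apply: val_inj; rewrite x'a xa.
by do 2 apply: val_inj; rewrite xb -x'b eqx.
Qed.

Lemma graph_comp (X Y Z : substr W) (f : smap X Y) (g : smap Y Z) a c :
  graph (scomp g f) a c <-> exists2 b, graph f a b & graph g b c.
Proof.
split=> [[x [xa xc]]|[b [x [xa xb]] [y [yb yc]]]].
  have [b xb] := image_preim (val (f x)); exists b; first by exists x.
  by exists (f x).
exists x; split=> //=; have -> // : f x = y.
by do 2 apply: val_inj; rewrite xb yb.
Qed.

Lemma graph_match (X Y Z : substr W) (f : smap X Y) (g : smap Y Z) b :
  is_isomorphism f -> (exists a, graph f a b) <-> (exists c, graph g b c).
Proof.
move=> [_ [k fk kf]]; split=> [[a [x [_ xb]]]|[c [y [yb _]]]].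
  by have [c gc] := image_preim (val (g (f x))); exists c, (f x).
have [a ka] := image_preim (val (k y)).
by exists a, (k y); rewrite kf.
Qed.

Lemma iso_comp (X Y Z : substr W) (f : smap X Y) (g : smap Y Z) :
  is_isomorphism f -> is_isomorphism g -> is_isomorphism (scomp g f).
Proof.
by move=> [fE fb] [gE gb]; split; [exact: embedding_comp|exact: bij_comp].
Qed.

End Isomorphisms.
End PartialAutomorphisms.

(** * The tower of lifts *)

Section Tower.
Local Open Scope classical_set_scope.
Variables (L : language) (unary : unary_functions L) (A B0 : structure L).
Variables (enum0 : seq B0) (enum0_axiom : Finite.axiom enum0).
Variables (psi0 : smap A B0) (psi0_emb : is_embedding psi0).

(** The carrier and the countable structure of [B0] are kept, so that maps to [base] are maps to
    [B0]. *)
Definition base_vertex : finType :=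
  HB.pack_for finType (Countable.sort B0) (Countable.class B0)
    (isFinite.Build B0 enum0_axiom).

Definition base : gstr L A :=
  @GStr L A base_vertex (@srel L B0) (fun F x y => sfun F [:: x : B0] y)
    (fun _ _ => true) psi0.

Lemma base_wf : gstr_wf base.
Proof.
split=> // [R s|F a y ay]; first exact: srel_size.
have [|b _ eqb] := embedding_closed psi0_emb _ ay; last by exists b.
by move=> z; rewrite mem_seq1 => /eqP ->; exists a.
Qed.

Definition pindex : Type :=
  {q : lperm L * (A -> A -> Prop) | partial_aut psi0 q.1 q.2}.
Definition plang (i : pindex) : lperm L := (sval i).1.
Definition pgraph (i : pindex) : A -> A -> Prop := (sval i).2.

Lemma automorphism_perm (t : smap B0 B0) : is_automorphism t ->
  exists g : {perm base}, gaut (B := base) (lmap t) g /\ forall x, g x = t x.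
Proof.
move=> [[Gt ti tr tf] _]; exists (perm (ti : injective (vmap t : base -> base))).
split=> [|x]; last by rewrite permE.
split=> // [R s|F x y]; rewrite ?permE.
  by rewrite (eq_map (permE (ti : injective (vmap t : base -> base)))); apply: tr.
have /= <- := tf F [:: x]; split=> [xy|[z xz /ti <-//]].
by exists y.
Qed.

Lemma base_hat : eppa_for psi0 -> exists hat : pindex -> {perm base},
  extending plang pgraph hat /\
  (coherent_for psi0 -> functorial plang pgraph hat).
Proof.
(* Without coherence any choice of extensions will do; otherwise they are taken from the coherent
   choice. *)
move=> [pE ext]; have [coh|ncoh] := pselect (coherent_for psi0); last first.
  have /choice[hat hatP] : forall i : pindex, exists g : {perm base},
      gaut (B := base) (plang i) g /\
      forall a b, pgraph i a b -> g (chart base a) = chart base b.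
    move=> i; have [X [Y [f [fI lf gf]]]] := iso_of_partial_aut unary pE (proj2_sig i).
    have [t [tA [lt tf]]] := ext X Y f fI.
    have [g [gA gt]] := automorphism_perm tA.
    exists g; split; first by rewrite /plang -lf -lt.
    by move=> a b /gf[x [xa xb]]; rewrite gt /= -xa tf xb.
  by exists hat.
have [pE' [h [hP hF]]] := coh.
pose W := image_substr pE'.
have /choice[w wP] : forall i : pindex,
    exists w : {X : substr W & {Y : substr W & smap X Y}},
      [/\ is_isomorphism (projT2 (projT2 w)), lmap (projT2 (projT2 w)) = plang i &
          forall a b, graph (projT2 (projT2 w)) a b <-> pgraph i a b].
  move=> i; have [X [Y [f fP]]] := iso_of_partial_aut unary pE' (proj2_sig i).
  by exists (existT _ X (existT _ Y f)).
pose t i := h _ _ (projT2 (projT2 (w i))).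
have tP i : is_automorphism (t i) /\ extends (projT2 (projT2 (w i))) (t i).
  by apply: hP; have [] := wP i.
have /choice[hat hatP] := fun i => automorphism_perm (tP i).1.
exists hat; split=> [i|_ i j k [lk gk mij] x].
  have [gA gt] := hatP i; have [_ [lt tf]] := tP i; have [fI lf gf] := wP i.
  split; first by rewrite -lf -lt.
  by move=> a b /gf[y [ya yb]]; rewrite gt /= -ya tf yb.
rewrite (hatP k).2 (hatP j).2 (hatP i).2 /t.
move: (wP i) (wP j) (wP k).
case: (w i) (w j) (w k) => X1 [Y1 f1] [X2 [Y2 f2]] [X3 [Y3 f3]] /=.
move=> [f1I l1 g1] [f2I l2 g2] [f3I l3 g3].
(* Domain and range can be read off the graphs, which forces the substructures to match. Then [f3]
   is the composite and coherence of [h] applies. *)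
have eqY : Y1 = X2.
  apply: substr_eq; apply/predeqP => v; rewrite (sset_ran v f1I) (sset_dom f2 v).
  split=> [[a [b [/g1 ab ->]]]|[b [d [/g2 bd ->]]]].
    have [d bd] : exists d, pgraph j b d by apply/mij; exists a.
    by exists b, d; split=> //; apply/g2.
  have [a ab] : exists a, pgraph i a b by apply/mij; exists d.
  by exists a, b; split=> //; apply/g1.
subst X2.
have eqg a d : graph f3 a d <-> graph (scomp f2 f1) a d.
  rewrite graph_comp; split=> [/g3/gk[b /g1 ab /g2 bd]|[b /g1 ab /g2 bd]].
    by exists b.
  by apply/g3/gk; exists b.
have f21I := iso_comp f1I f2I.
have eqX : X1 = X3.
  apply: substr_eq; apply/predeqP => v.
  rewrite (sset_dom (scomp f2 f1) v) (sset_dom f3 v).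
  by split=> -[a [d [/eqg ad ->]]]; exists a, d.
have eqZ : Y2 = Y3.
  apply: substr_eq; apply/predeqP => v.
  rewrite (sset_ran v f21I) (sset_ran v f3I).
  by split=> -[a [d [/eqg ad ->]]]; exists a, d.
subst X3 Y3; have -> : f3 = scomp f2 f1.
  apply: smap_eq; first by rewrite l3 lk /= l1 l2.
  by move=> a d /eqg.
by rewrite hF.
Qed.

Definition tower (B : gstr L A) : Prop :=
  [/\ gstr_wf B, exists q : B -> base, covering q &
      exists hat : pindex -> {perm B}, extending plang pgraph hat /\
        (coherent_for psi0 -> functorial plang pgraph hat)].

Lemma tower_base : eppa_for psi0 -> tower base.
Proof.
move=> /base_hat hatP; split=> //; first exact: base_wf.
exists id; split=> // [F x y xy|R s _]; first by exists y.
by rewrite map_id.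
Qed.

Lemma tower_step m (B : gstr L A) : tower B ->
  exists (B' : gstr L A) (p : B' -> B), [/\ tower B', covering p,
    forall Q : {set B'}, clique Q -> in_copy (p @: Q) -> in_copy Q &
    colors_feasible m p].
Proof.
move=> [Bwf [q qC] [hat [hatE hatF]]].
have [B' [p [hat' [[B'wf pC hatE'] [hatF' pL pF]]]]] := stage_step m Bwf hatE.
exists B', p; split=> //; split=> //; first by exists (q \o p); apply: covering_comp qC.
by exists hat'; split=> // /hatF.
Qed.

Lemma tower_small_cliques j : eppa_for psi0 ->
  exists B : gstr L A, tower B /\ small_cliques_in_copies j B.
Proof.
move=> ext; elim: j => [|j [B [BT Bj]]].
  exists base; split; first exact: tower_base.
  move=> Q _; rewrite leqn0 cards_eq0 => /eqP ->.
  by exists (id, id), 1%g; split; [exact: gaut1|move=> x; rewrite finset.in_set0].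
have [B' [p [B'T pC pL pF]]] := tower_step j BT.
by exists B'; split=> //; apply: small_cliques_step pC pL pF Bj.
Qed.

(** A clique projects injectively to [base], so it suffices to treat cliques of at most [#|base|]
    elements. *)
Lemma tower_cliques : eppa_for psi0 ->
  exists B : gstr L A, tower B /\ cliques_in_copies B.
Proof.
move=> /(tower_small_cliques #|base|)[B [BT BQ]]; exists B; split=> // Q qQ.
have [_ [q qC] _] := BT.
apply: BQ => //; rewrite -(card_in_imset (f := q) (D := mem Q)) ?max_card //.
exact: covering_clique_inj.
Qed.

(** * EPPA, faithfulness, projection and trees at a level of the tower *)

Section TowerStructure.
Variables (B : gstr L A) (Bwf : gstr_wf B) (q : B -> base) (qC : covering q).
Let M : structure L := gstructure unary Bwf.

(** A lifted function value stays in the chart by [chart_fun] and is identified by its projection,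
    as [psi0] is injective. With [tower_rel], the chart is thus isomorphic to the copy in [B0]. *)
Lemma tower_fun F a b :
  sfun F [:: chart B a : M] (chart B b) <-> sfun F [:: psi0 a] (psi0 b).
Proof.
have qE d : q (chart B d) = psi0 d by rewrite (cov_chart qC).
split=> [/gsfun1 /(cov_fun qC)|ab]; first by rewrite !qE.
apply/gsfun1; have [|y ay qy] := cov_fun_lift (F := F) (x := chart B a) (y := psi0 b) qC.
  by rewrite qE.
have [b' eqy] := chart_fun Bwf ay; have [_ pi _ _] := psi0_emb.
by have <- : b' = b; [apply: pi; rewrite -qE -eqy|rewrite -eqy].
Qed.

Lemma tower_rel R s : @srel L M R (map (chart B) s) <-> srel R (map psi0 s).
Proof.
rewrite /= (cov_rel qC R); last first.
  by move=> _ _ /mapP[a _ ->] /mapP[b _ ->]; apply: chart_guard.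
by rewrite -map_comp (eq_map (cov_chart qC)).
Qed.

Lemma tower_chart_embedding : is_embedding (chart_smap unary Bwf (lmap psi0)).
Proof.
have [Gl pi pr pf] := psi0_emb; split=> //=.
- move=> a b eqab; apply: pi; rewrite -[LHS]/(chart base a) -[RHS]/(chart base b).
  by rewrite -!(cov_chart qC) eqab.
- by move=> R s; rewrite pr -tower_rel.
- move=> F s.
  have fE a b : sfun F [:: a] b <-> @sfun L M ((lmap psi0).2 F) [:: chart B a] (chart B b).
    rewrite tower_fun; have /= <- := pf F [:: a].
    by split=> [ab|[d ad /pi <-]]; first exists b.
  apply/seteqP; split=> [_ [b sb <-]|y sy].
    have [a eqs] := sfun_unary unary sb; rewrite eqs /=; apply/fE.
    by rewrite -eqs.
  have [x] := sfun_unary (M := M) unary sy; case: s sy => [|a []] //= sy _.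
  have /gsfun1 ay := sy; have [b eqy] := chart_fun Bwf ay.
  by exists b; rewrite ?eqy //; apply/fE; rewrite -eqy.
Qed.

Definition chart0 : smap A M := chart_smap unary Bwf (lmap psi0).
Let chart0_emb : is_embedding chart0 := tower_chart_embedding.

Lemma tower_partial_aut (X Y : substr (image_substr chart0_emb)) (f : smap X Y) :
  is_isomorphism f -> partial_aut psi0 (lmap f) (graph f).
Proof.
move=> /partial_aut_iso; apply: partial_aut_transfer => [F a b|R s].
  exact: tower_fun.
exact: tower_rel.
Qed.

Definition iso_index (X Y : substr (image_substr chart0_emb)) (f : smap X Y)
    (fI : is_isomorphism f) : pindex :=
  exist (fun i : lperm L * (A -> A -> Prop) => partial_aut psi0 i.1 i.2)
    (lmap f, graph f) (tower_partial_aut fI).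

Variable hat : pindex -> {perm B}.
Hypothesis hatE : extending plang pgraph hat.

(** The second branch is a default: [coherent_for] asks for a value at every map but constrains
    isomorphisms only. *)
Definition iso_hat (X Y : substr (image_substr chart0_emb)) (f : smap X Y) : smap M M :=
  match pselect (is_isomorphism f) with
  | left fI => perm_smap unary Bwf (lmap f) (hat (iso_index fI))
  | right _ => SMap (lmap f) id
  end.

Lemma iso_hatP (X Y : substr (image_substr chart0_emb)) (f : smap X Y) :
  is_isomorphism f -> is_automorphism (iso_hat f) /\ extends f (iso_hat f).
Proof.
rewrite /iso_hat; case: pselect => // fI _.
have [gA gE] := hatE (iso_index fI); split; first exact: gaut_automorphism gA.
split=> // x; have [a xa] := image_preim (val x).
have [b xb] := image_preim (val (f x)); rewrite xa xb /=; apply: gE.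
by exists x.
Qed.

Lemma tower_eppa : eppa_for chart0.
Proof.
exists chart0_emb => X Y f fI; exists (iso_hat f); exact: iso_hatP.
Qed.

Lemma tower_coherent : functorial plang pgraph hat -> coherent_for chart0.
Proof.
move=> hatF; exists chart0_emb, iso_hat; split=> [X Y f|X Y Z f g fI gI].
  exact: iso_hatP.
rewrite /iso_hat; case: pselect => [gfI|]; last by case; apply: iso_comp.
case: pselect => // gI'; case: pselect => // fI'.
congr SMap; apply/funext => x /=; apply: hatF; split=> //.
  by move=> a d; apply: graph_comp.
by move=> b; apply: graph_match.
Qed.

(** An irreducible substructure is a clique, hence lies in a translate of the chart; the inverse
    automorphism moves it into the chart. *)
Lemma tower_faithful : cliques_in_copies B -> irreducible_structure_faithful_for chart0.
Proof.
move=> qB C Cirr; pose Q : {set B} := [set x : B | `[< sset C x >]]%SET.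
have qQ : clique Q.
  move=> x y; rewrite !finset.in_set => /asboolP Cx /asboolP Cy.
  exact: (irreducible_guard (Defs.incl_embedding C) Cirr
    (in_substr (mem_set Cx)) (in_substr (mem_set Cy))).
have [l [g [gA gQ]]] := qB Q qQ; have [l' gA'] := gaut_inv gA.
exists (perm_smap unary Bwf l' (g^-1)%g); split; first exact: gaut_automorphism.
move=> _ [x Cx <-]; have [|a ->] := gQ x; first by rewrite finset.in_set; apply/asboolP.
by exists a => //=; rewrite permK.
Qed.

(** A covering is a local embedding on the set of all vertices. *)
Lemma tower_hom : is_hom_embedding (idmap (q : M -> B0)).
Proof.
have idE : is_embedding (to_gstructure unary Bwf (fun x : M => x)).
  split=> //=; [exact: lang_grp1|by move=> R s; rewrite map_id|].
  by move=> F s; rewrite map_id image_id.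
apply: (local_hom_embedding (S := [set: B]%SET) (D := B0) (f := q) idE) => //.
split=> [F x d _|x y _ _|R s _ sg].
- split=> [/(cov_fun_lift qC)//|[y xy <-]]; exact: (cov_fun qC xy).
- exact: (cov_inj qC).
- exact: (cov_rel qC R sg).
Qed.

Lemma tower_trees n : trees_below (n * n).+1 B ->
  forall C : substr M, (sset C #<= `I_n)%card ->
    exists (D : structure L) (f : smap C D), tree_amalgamation A D /\ is_hom_embedding f.
Proof.
move=> tB C Cn; pose S : {set B} := [set x : B | `[< sset C x >]]%SET.
have cS : closed_in S.
  move=> F x y; rewrite !finset.in_set => /asboolP Cx xy; apply/asboolP.
  apply: (@sset_closed _ _ C F [:: x]); last by apply/gsfun1.
  by move=> z; rewrite mem_seq1 => /eqP ->.
have Sn : #|S| <= n.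
  have finC : finite_set (sset C) by apply/finite_set_leP; exists n.
  apply: leq_trans (geq_card_fset_set Cn); rewrite cardE.
  apply: uniq_leq_size; first exact: enum_uniq.
  move=> x; rewrite mem_enum finset.in_set => /asboolP Cx.
  by have := in_fset_set finC x; rewrite (mem_set Cx).
have [|D [f [TD fL _]]] := tB S cS.
  rewrite ltnS; apply: leq_trans (leq_mul Sn Sn); rewrite -cardsX.
  apply/subset_leq_card/fintype.subsetP => -[x y].
  by rewrite finset.in_setX finset.in_set /= => /and3P[-> ->].
exists D, (idmap (fun x : C => f (val x))); split=> //.
apply: (local_hom_embedding (e := fun x : C => val x : B) (Defs.incl_embedding C) _ fL) => x.
by rewrite finset.in_set; apply/asboolP; apply: set_mem (valP x).
Qed.

End TowerStructure.

(** Lifts inherit the property of cliques, because cliques project to cliques; each further lift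
    with two colours admits one more unguarded pair. *)
Lemma tower_exists n : eppa_for psi0 -> exists B : gstr L A,
  [/\ tower B, cliques_in_copies B & trees_below n B].
Proof.
move=> ext; elim: n => [|n [B [BT qB tB]]].
  (* [trees_below 0] holds vacuously. *)
  by have [B [BT qB]] := tower_cliques ext; exists B.
have [B' [p [B'T pC pL pF]]] := tower_step 2 BT.
have [Bwf [q qC] _] := BT.
exists B'; split=> // [Q qQ|].
  by apply: pL => //; apply: qB; apply: covering_clique qQ.
by apply: (trees_below_step (tower_chart_embedding Bwf qC) qB pC pF tB).
Qed.

End Tower.

Theorem theorem1p2 :
  forall (L : language), unary_functions L ->
  forall (A : structure L), finite_structure A -> irreducible A ->
  forall (B0 : structure L), finite_structure B0 -> eppa_witness A B0 ->
  forall n : nat, (1 <= n)%N ->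
  exists B : structure L,
    finite_structure B /\
    irreducible_structure_faithful_eppa_witness A B /\
    (exists f : smap B B0, is_hom_embedding f) /\
    (forall C : substr B, (sset C #<= `I_n)%card ->
       exists (D : structure L) (f : smap C D),
         tree_amalgamation A D /\ is_hom_embedding f) /\
    (coherent_eppa_witness A B0 -> coherent_eppa_witness A B).
Proof.
move=> L unary A _ _ B0 finB0 wit n _.
(* The embedding is taken from a coherent witness whenever there is one, so that a single tower
   serves all the claims. *)
have [psi [ext coh]] : exists psi : smap A B0,
    eppa_for psi /\ (coherent_eppa_witness A B0 -> coherent_for psi).
  have [[psi [ext cohp]]|ncoh] := pselect (coherent_eppa_witness A B0).
    by exists psi.
  by have [psi ext] := wit; exists psi.
have [psi_emb _] := ext.
have [s enumP] : exists s : seq B0, Finite.axiom s.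
  have /finite_seqP[s eqs] := finB0; exists (undup s) => x.
  rewrite count_uniq_mem ?undup_uniq // mem_undup.
  by have /= -> : [set` s]%classic x by rewrite -eqs.
(* At most [n] vertices span at most [n * n] unguarded pairs, which is less than the bound chosen
   here. *)
have [B [[Bwf [q qC] [hat [hatE hatF]]] qB tB]] :=
  tower_exists unary enumP psi_emb (n * n).+1 ext.
exists (gstructure unary Bwf); split; first exact: (@finite_finset B).
split.
  exists (chart0 unary psi Bwf); split; first exact: (tower_eppa unary psi_emb Bwf qC hatE).
  exact: (tower_faithful psi qB).
split; first by eexists; apply: (tower_hom unary Bwf qC).
split; first exact: (tower_trees tB).
move=> /coh/hatF hF; exists (chart0 unary psi Bwf).
split; first exact: (tower_eppa unary psi_emb Bwf qC hatE).
exact: (tower_coherent unary psi_emb Bwf qC hatE hF).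
Qed.
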